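(* Suppose that $\mathcal M\models\mathsf{PA}$ and $\mathcal M$ is countably generated over the cut $I$ of $\mathcal M$. The following are equivalent: (1) $\operatorname{dcf}(I)=\aleph_0$ and $I$ is exponentially closed. (2) There is a countably generated extension $\mathcal N\succ_{\sf cf}\mathcal M$ such that $\operatorname{GCIS}(\mathcal M,\mathcal N)=I$ and $\operatorname{Cod}(\mathcal N/I)=\operatorname{Cod}(\mathcal M/I)$. (3) There is a non-filling extension $\mathcal N\succ_{\sf cf}\mathcal M$ that is generated over $\mathcal M$ by an element realizing an indiscernible type over $\mathcal M$ such that $\operatorname{GCIS}(\mathcal M,\mathcal N)=I$ and $\operatorname{Cod}(\mathcal N/I)=\operatorname{Cod}(\mathcal M/I)$.
   Context: $\mathsf{PA}$ is Peano Arithmetic in the language $\{+,\times,0,1,\le\}$; structures $\mathcal M,\mathcal N,\dots$ have universes $M,N,\dots$. $\mathcal N\succ\mathcal M$ means $\mathcal N$ is a proper elementary extension of $\mathcal M$; $\mathcal N\succ_{\sf cf}\mathcal M$ means in addition that $M$ is cofinal in $\mathcal N$. $\operatorname{Def}(\mathcal M)$ is the set of subsets of $M$ definable in $\mathcal M$ with parameters; for $X\subseteq M$, $\operatorname{Cod}(\mathcal M/X)=\{X\cap D: D\in\operatorname{Def}(\mathcal M)\}$. A cut $I$ of $\mathcal M$ is a nonempty proper subset of $M$ such that $a\in I$ whenever $b\in I$ and $a\le b+1$; it is exponentially closed if $2^a\in I$ whenever $a\in I$. The downward cofinality $\operatorname{dcf}(I)$ is the least cardinal $\kappa$ for which there is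 $X\subseteq M\setminus I$ with $|X|=\kappa$ and $I=\{y\in M: y<x\text{ for all }x\in X\}$. A set $X\subseteq M$ generates $\mathcal M$ if there is no $\mathcal K\prec\mathcal M$ with $X\subseteq K$. $\mathcal M$ is countably generated over $I\subseteq M$ if there is a countable $X\subseteq M$ such that $X\cup I$ generates $\mathcal M$. An extension $\mathcal N\succ\mathcal M$ is countably generated if $\mathcal N$ is countably generated over $M$; it is generated by an element $c$ if $M\cup\{c\}$ generates $\mathcal N$. For $\mathcal M\prec\mathcal N$, $\operatorname{GCIS}(\mathcal M,\mathcal N)=\{b\in M:[0,b]^{\mathcal M}=[0,b]^{\mathcal N}\}$. An extension $\mathcal N\succ_{\sf cf}\mathcal M$ is filling if there is $a\in N$ such that $x<a<y$ whenever $x\in\operatorname{GCIS}(\mathcal M,\mathcal N)$ and $y\in M\setminus\operatorname{GCIS}(\mathcal M,\mathcal N)$; otherwise it is non-filling. A $1$-type $p(x)$ over $\mathcal M$ (in the language with constants for elements of $M$) is $n$-indiscernible ($1\le n<\omega$) if it is nonprincipal and for every $n$-ary formula $\theta(\overline x)$ with parameters from $M$ there is $\varphi(x)\in p(x)$ such that $\mathcal M\models\forall\overline x,\overline y\big[\bigwedge_{i<n}(\varphi(x_i)\wedge\varphi(y_i))\wedge\bigwedge_{i<n-1}(x_i<x_{i+1}\wedge y_i<y_{i+1})\to(\theta(\overline x)\leftrightarrow\theta(\overline y))\big]$. The type is indiscernible if it is $n$-indiscernible for all $1\le n<\omega$. *)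

(* Defs.v *)
From mathcomp Require Import all_boot.
From mathcomp Require Import boolp classical_sets functions cardinality.

Set Implicit Arguments.
Unset Strict Implicit.
Unset Printing Implicit Defensive.

Local Open Scope classical_set_scope.
Local Open Scope card_scope.

(* Variables are de Bruijn indices: [Var 0] refers to the innermost quantifier. *)
Inductive term : Type :=
| Var of nat
| Zero
| One
| Add of term & term
| Mul of term & term.

Inductive formula : Type :=
| Eq of term & term
| Le of term & term
| Not of formula
| And of formula & formula
| Or of formula & formula
| Imp of formula & formula
| All of formula
| Ex of formula.

Definition scons (T : Type) (x : T) (e : nat -> T) : nat -> T :=
  fun k => if k is k'.+1 then e k' else x.

Fixpoint tsubst (s : nat -> term) (t : term) : term :=
  match t with
  | Var k => s k
  | Zero => Zero
  | One => One
  | Add t1 t2 => Add (tsubst s t1) (tsubst s t2)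
  | Mul t1 t2 => Mul (tsubst s t1) (tsubst s t2)
  end.

Definition up (s : nat -> term) : nat -> term :=
  scons (Var 0) (fun k => tsubst (fun i => Var i.+1) (s k)).

Fixpoint fsubst (s : nat -> term) (f : formula) : formula :=
  match f with
  | Eq t1 t2 => Eq (tsubst s t1) (tsubst s t2)
  | Le t1 t2 => Le (tsubst s t1) (tsubst s t2)
  | Not g => Not (fsubst s g)
  | And g h => And (fsubst s g) (fsubst s h)
  | Or g h => Or (fsubst s g) (fsubst s h)
  | Imp g h => Imp (fsubst s g) (fsubst s h)
  | All g => All (fsubst (up s) g)
  | Ex g => Ex (fsubst (up s) g)
  end.

Record arith_structure := ArithStructure {
  carrier :> Type;
  ar_zero : carrier;
  ar_one : carrier;
  ar_add : carrier -> carrier -> carrier;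
  ar_mul : carrier -> carrier -> carrier;
  ar_le : carrier -> carrier -> Prop
}.
Arguments ar_zero {_}.
Arguments ar_one {_}.

Definition ar_lt (M : arith_structure) (x y : M) : Prop := ar_le x y /\ x <> y.

Declare Scope arith_scope.
Delimit Scope arith_scope with A.
Notation "0" := ar_zero : arith_scope.
Notation "1" := ar_one : arith_scope.
Notation "x + y" := (ar_add x y) : arith_scope.
Notation "x * y" := (ar_mul x y) : arith_scope.
Notation "x <= y" := (ar_le x y) : arith_scope.
Notation "x < y" := (ar_lt x y) : arith_scope.

Fixpoint eval (M : arith_structure) (e : nat -> M) (t : term) : M :=
  match t with
  | Var k => e k
  | Zero => 0%A
  | One => 1%A
  | Add t1 t2 => (eval e t1 + eval e t2)%A
  | Mul t1 t2 => (eval e t1 * eval e t2)%A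
  end.

Fixpoint sat (M : arith_structure) (e : nat -> M) (f : formula) : Prop :=
  match f with
  | Eq t1 t2 => eval e t1 = eval e t2
  | Le t1 t2 => (eval e t1 <= eval e t2)%A
  | Not g => ~ sat e g
  | And g h => sat e g /\ sat e h
  | Or g h => sat e g \/ sat e h
  | Imp g h => sat e g -> sat e h
  | All g => forall x : M, sat (scons x e) g
  | Ex g => exists x : M, sat (scons x e) g
  end.

(* The free variables of a member of [T] are read as universally quantified. *)
Definition models (M : arith_structure) (T : set formula) : Prop :=
  forall f, T f -> forall e : nat -> M, sat e f.

Inductive PA : set formula :=
| PA_succ_neq0 : PA (Not (Eq (Add (Var 0) One) Zero))
| PA_succ_inj :
    PA (Imp (Eq (Add (Var 0) One) (Add (Var 1) One)) (Eq (Var 0) (Var 1)))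
| PA_add0 : PA (Eq (Add (Var 0) Zero) (Var 0))
| PA_addS :
    PA (Eq (Add (Var 0) (Add (Var 1) One)) (Add (Add (Var 0) (Var 1)) One))
| PA_mul0 : PA (Eq (Mul (Var 0) Zero) Zero)
| PA_mulS :
    PA (Eq (Mul (Var 0) (Add (Var 1) One)) (Add (Mul (Var 0) (Var 1)) (Var 0)))
| PA_le_add :
    PA (Imp (Le (Var 0) (Var 1)) (Ex (Eq (Add (Var 1) (Var 0)) (Var 2))))
| PA_add_le :
    PA (Imp (Ex (Eq (Add (Var 1) (Var 0)) (Var 2))) (Le (Var 0) (Var 1)))
| PA_induction (f : formula) :
    (* f(0) -> (forall x, f(x) -> f(x + 1)) -> forall x, f(x), where x is
       [Var 0] in [f] and the other free variables of [f] are parameters *)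
    PA (Imp (fsubst (scons Zero Var) f)
       (Imp (All (Imp f (fsubst (scons (Add (Var 0) One)
                                       (fun k => Var k.+1)) f)))
            (All f))).

(* An n-ary formula with parameters from [M] is a pair [(f, e)]: the variables
   0, ..., n-1 of [f] are its arguments, and the variable n + k is (the constant
   naming) the parameter [e k].  Only finitely many [e k] matter. *)
Definition formula_over (M : arith_structure) : Type :=
  (formula * (nat -> M))%type.

(* [xs] satisfies, in [N], the formula with parameters [th], the parameters
   being transported along [j]; the arity of [th] is [size xs]. *)
Definition sat_over (M N : arith_structure) (j : M -> N) (th : formula_over M)
    (xs : seq N) : Prop :=
  sat (foldr (@scons N) (j \o th.2) xs) th.1.

Definition Def (M : arith_structure) : set (set M) :=
  [set D | exists th : formula_over M, D = [set x | sat_over id th [:: x]]].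
Arguments Def : clear implicits.

Definition Cod (M : arith_structure) (X : set M) : set (set M) :=
  [set X `&` D | D in Def M].

(* An extension of [M] is given by an embedding [j : M -> N]; the subset X of
   [M] is then identified with its image [j @` X] in [N]. *)
Definition elementary (M N : arith_structure) (j : M -> N) : Prop :=
  forall (f : formula) (e : nat -> M), sat e f <-> sat (j \o e) f.

Definition proper_elementary (M N : arith_structure) (j : M -> N) : Prop :=
  elementary j /\ range j <> setT.

Definition cofinal_extension (M N : arith_structure) (j : M -> N) : Prop :=
  proper_elementary j /\ forall y : N, exists x : M, (y <= j x)%A.

Definition generates (M : arith_structure) (X : set M) : Prop :=
  ~ exists (K : arith_structure) (k : K -> M),
      proper_elementary k /\ X `<=` range k.

Definition countably_generated_over (M : arith_structure) (Y : set M) : Prop :=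
  exists2 X : set M, countable X & generates (X `|` Y).

Definition countably_generated_extension (M N : arith_structure) (j : M -> N) :
    Prop :=
  countably_generated_over (range j).

Definition generated_by (M N : arith_structure) (j : M -> N) (c : N) : Prop :=
  generates (range j `|` [set c]).

Definition GCIS (M N : arith_structure) (j : M -> N) : set M :=
  [set b | j @` [set x | (x <= b)%A] = [set y | (y <= j b)%A]].

Definition filling (M N : arith_structure) (j : M -> N) : Prop :=
  exists a : N, forall x y : M,
    GCIS j x -> ~ GCIS j y -> (j x < a)%A /\ (a < j y)%A.

(* Cod(N / X) = Cod(M / X) for X a subset of [M]. *)
Definition same_Cod (M N : arith_structure) (j : M -> N) (X : set M) : Prop :=
  Cod (j @` X) = [set j @` A | A in Cod X].

Definition is_cut (M : arith_structure) (I : set M) : Prop :=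
  [/\ I !=set0, I <> setT &
      forall a b : M, I b -> (a <= b + 1)%A -> I a].

(* Goedel's beta function: u is the remainder of c divided by 1 + (i + 1) d. *)
Definition beta (M : arith_structure) (c d i u : M) : Prop :=
  (u < 1 + (i + 1) * d)%A /\
  exists q : M, c = (q * (1 + (i + 1) * d) + u)%A.

(* b = 2 ^ a, in the sense of [M]: some (c, d) codes a sequence of length a + 1
   that starts with 1, doubles at each step and ends with b. *)
Definition is_pow2 (M : arith_structure) (a b : M) : Prop :=
  exists c d : M,
    [/\ beta c d 0%A 1%A,
        forall i u : M, (i < a)%A -> beta c d i u ->
          beta c d (i + 1)%A ((1 + 1) * u)%A
      & beta c d a b].

Definition exp_closed (M : arith_structure) (I : set M) : Prop :=
  forall a : M, I a -> exists2 b : M, is_pow2 a b & I b.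

Definition downward_cofinal (M : arith_structure) (I X : set M) : Prop :=
  X `<=` ~` I /\ I = [set y | forall x, X x -> (y < x)%A].

(* dcf(I) is the cardinality of [K]. *)
Definition dcf_is (M : arith_structure) (I : set M) (T : Type) (K : set T) :
    Prop :=
  (exists2 X : set M, downward_cofinal I X & X #= K) /\
  forall X : set M, downward_cofinal I X -> K #<= X.

(* Complete 1-types over [M]; being finitely satisfiable in [M] is the same as
   being consistent with the elementary diagram of [M]. *)
Definition is_type1 (M : arith_structure) (p : set (formula_over M)) : Prop :=
  (forall F : set (formula_over M), finite_set F -> F `<=` p ->
     exists x : M, forall th, F th -> sat_over id th [:: x]) /\
  forall (f : formula) (e : nat -> M), p (f, e) \/ p (Not f, e).

Definition principal (M : arith_structure) (p : set (formula_over M)) : Prop :=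
  exists2 phi, p phi &
    forall th, p th ->
      forall x : M, sat_over id phi [:: x] -> sat_over id th [:: x].

Definition increasing (M : arith_structure) (n : nat) (x : n.-tuple M) : Prop :=
  forall i k : 'I_n, k = i.+1 :> nat -> (tnth x i < tnth x k)%A.

Definition n_indiscernible (M : arith_structure) (n : nat)
    (p : set (formula_over M)) : Prop :=
  ~ principal p /\
  forall th : formula_over M, exists2 phi, p phi &
    forall x y : n.-tuple M,
      (forall i : 'I_n, sat_over id phi [:: tnth x i] /\
                        sat_over id phi [:: tnth y i]) ->
      increasing x -> increasing y ->
      (sat_over id th x <-> sat_over id th y).

Definition indiscernible (M : arith_structure) (p : set (formula_over M)) :
    Prop :=
  forall n : nat, (1 <= n)%N -> n_indiscernible n p.

Definition realizes (M N : arith_structure) (j : M -> N) (c : N)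
    (p : set (formula_over M)) : Prop :=
  forall th, p th -> sat_over j th [:: c].

(* Main.v *)
Require Import Defs.
From mathcomp Require Import all_boot.
From mathcomp Require Import boolp classical_sets functions cardinality.
From Stdlib Require Import Ring.
Set Implicit Arguments.
Unset Strict Implicit.
Unset Printing Implicit Defensive.
Local Open Scope classical_set_scope.

(** The hard implications are from the first condition to the third and from the
    second to the first; an extension generated by one element is countably
    generated.

    _From the cut to the extension._  The element [c] realizes a type generated by a
    descending sequence of definable sets [S_k], each coded as an increasing
    sequence whose length is a number outside [I].  If [S_k] has this size and [R] is
    a definable relation between [n]-tuples and elements of [I], then Ramsey's theorem
    inside [M] gives a subset of the same kind on which [R] is homogeneous,
    uniformly in the elements of [I] ([ramsey]): the bounds in the theorem are
    iterated exponentials, so every size in [I] can be reached because [I] is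
    exponentially closed, and overspill gives a size outside [I].  As [M] is
    countably generated over [I], all definable relations fall into countably many
    families indexed by [I], so that a sequence of length omega deals with all of
    them; as the complement of [I] has a countable coinitial sequence, the sizes of
    the [S_k] can be made coinitial at the same time ([homogeneous_chain]).

    The model generated by [c] is the ultrapower of [M] by definable functions.
    Homogeneity for unary relations says that for every definable [R] some [S_k] decides
    [R x y] for all [y] in [I] at once ([decided]).  This gives everything about [I]:
    bounded values of functions are constant, so no element is added below an element
    of [I]; the sets coded in the extension are coded in [M]; and a function that
    exceeds all elements of [I] has a least value on [S_k], which is outside
    [I] and below its class, so the extension is not filling.  Below
    every element outside [I] there is a new one, the index of [c] in a sufficiently
    short [S_k].

    _From the extension to the cut._  If [a] is in [I] but [2 ^ a] is not, there is a
    new number below [2 ^ a]; its binary digits form a subset of [I], hence are coded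
    in [M], so that the number was not new.  For the downward cofinality, consider the
    countably many functions that generate [M] or [N] from [I]; each of them gives
    an element outside [I], and these are coinitial ([extension_dcf]).  In the
    non-filling case the element for [g] is such that the values of [g] on [I] below it
    belong to [M]: their digits at places in [I] are coded in [M], and by overspill
    this coding is correct up to a place outside [I] ([small_values]).  In the
    filling case [M] can separate the values in [I] from the others, and by
    overspill the others have a lower bound outside [I] ([values_outside]).

    All this takes place inside models of Peano arithmetic, so the first parts develop
    definable functions, the coding of sequences by the beta function, powers of
    two and binary digits from the axioms. *)

(** * Substitution and free variables *)

Section Syntax.
Context (M : arith_structure).
Implicit Types (e : nat -> M) (s : nat -> term).

Lemma eval_tsubst e s t :
  eval e (tsubst s t) = eval (fun k => eval e (s k)) t.
Proof. by elim: t => //= [t1 -> t2 ->|t1 -> t2 ->]. Qed.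

Lemma scons_up e s x :
  (fun k => eval (scons x e) (up s k)) = scons x (fun k => eval e (s k)).
Proof. by apply/funext => -[|k] //=; rewrite eval_tsubst. Qed.

Lemma sat_fsubst f e s :
  sat e (fsubst s f) <-> sat (fun k => eval e (s k)) f.
Proof.
elim: f e s => /=.
- by move=> t1 t2 e s; rewrite !eval_tsubst.
- by move=> t1 t2 e s; rewrite !eval_tsubst.
- by move=> f IH e s; rewrite IH.
- by move=> f IHf g IHg e s; rewrite IHf IHg.
- by move=> f IHf g IHg e s; rewrite IHf IHg.
- by move=> f IHf g IHg e s; rewrite IHf IHg.
- by move=> f IH e s; split=> h x; move: (h x); rewrite IH scons_up.
- by move=> f IH e s; split=> -[x h]; exists x; move: h; rewrite IH scons_up.
Qed.

End Syntax.

Fixpoint tbound (t : term) : nat :=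
  match t with
  | Var k => k.+1
  | Zero | One => 0
  | Add t1 t2 | Mul t1 t2 => maxn (tbound t1) (tbound t2)
  end.

Fixpoint fbound (f : formula) : nat :=
  match f with
  | Eq t1 t2 | Le t1 t2 => maxn (tbound t1) (tbound t2)
  | Not g => fbound g
  | And g h | Or g h | Imp g h => maxn (fbound g) (fbound h)
  | All g | Ex g => (fbound g).-1
  end.

Section Bound.
Context (M : arith_structure).
Implicit Types (e : nat -> M).

Lemma eval_tbound e e' t :
  (forall k, (k < tbound t)%N -> e k = e' k) -> eval e t = eval e' t.
Proof.
elim: t => //= [k h|t1 IH1 t2 IH2 h|t1 IH1 t2 IH2 h]; first exact: h.
- by rewrite IH1 ?IH2 // => k hk; apply: h; rewrite leq_max hk ?orbT.
- by rewrite IH1 ?IH2 // => k hk; apply: h; rewrite leq_max hk ?orbT.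
Qed.

Lemma sat_fbound f e e' :
  (forall k, (k < fbound f)%N -> e k = e' k) -> sat e f <-> sat e' f.
Proof.
elim: f e e' => /=.
- move=> t1 t2 e e' h.
  by rewrite (eval_tbound (e' := e') (t := t1)) ?(eval_tbound (e' := e') (t := t2)) //
    => k hk; apply: h; rewrite leq_max hk ?orbT.
- move=> t1 t2 e e' h.
  by rewrite (eval_tbound (e' := e') (t := t1)) ?(eval_tbound (e' := e') (t := t2)) //
    => k hk; apply: h; rewrite leq_max hk ?orbT.
- by move=> f IH e e' h; rewrite (IH e e').
- by move=> f IHf g IHg e e' h; rewrite (IHf e e') ?(IHg e e') // => k hk;
    apply: h; rewrite leq_max hk ?orbT.
- by move=> f IHf g IHg e e' h; rewrite (IHf e e') ?(IHg e e') // => k hk;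
    apply: h; rewrite leq_max hk ?orbT.
- by move=> f IHf g IHg e e' h; rewrite (IHf e e') ?(IHg e e') // => k hk;
    apply: h; rewrite leq_max hk ?orbT.
- move=> f IH e e' h.
  have E x : sat (scons x e) f <-> sat (scons x e') f.
    by apply: IH => -[|k] //= hk; apply: h; case: (fbound f) hk.
  by split=> H x; apply/E.
- move=> f IH e e' h.
  have E x : sat (scons x e) f <-> sat (scons x e') f.
    by apply: IH => -[|k] //= hk; apply: h; case: (fbound f) hk.
  by split=> -[x H]; exists x; apply/E.
Qed.

End Bound.

Section Environments.
Context (T : Type).
Lemma foldr_scons_lt (e e' : nat -> T) xs k : (k < size xs)%N ->
  foldr (@scons T) e xs k = foldr (@scons T) e' xs k.
Proof. by elim: xs k => [//|x xs IH] [|k] //=; rewrite ltnS => /IH. Qed.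
Lemma foldr_scons_ge (e : nat -> T) xs k :
  foldr (@scons T) e xs (size xs + k)%N = e k.
Proof. by elim: xs => [|x xs IH] //=. Qed.
Lemma foldr_scons_size (e : nat -> T) xs : foldr (@scons T) e xs (size xs) = e 0%N.
Proof. by rewrite -(foldr_scons_ge e xs 0) addn0. Qed.
Lemma foldr_scons_nth (e : nat -> T) x0 xs k : (k < size xs)%N ->
  foldr (@scons T) e xs k = nth x0 xs k.
Proof. by elim: xs k => [//|x xs IH] [|k] //=; rewrite ltnS => /IH. Qed.
End Environments.

(** * Definable relations *)

Section Definable.
Context (M : arith_structure) (A : set M).
Implicit Types (e : nat -> M).

Definition slot (e : nat -> M) (u : nat + M) : M :=
  match u with inl i => e i | inr c => c end.

(** Relations are predicates on whole environments: this way a definable relation is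
    written as an ordinary predicate in which the variables are the values [e i],
    and definability is proved by following its syntax, with no formula in
    sight.  The variables of the formula are either variables of the relation or
    parameters from [A]. *)
Definition dfn (R : (nat -> M) -> Prop) : Prop :=
  exists (f : formula) (s : nat -> nat + M),
    (forall k c, s k = inr c -> A c) /\
    forall e, R e <-> sat (fun k => slot e (s k)) f.

Definition dff (F : (nat -> M) -> M) : Prop :=
  dfn (fun e => e 0 = F (fun k => e k.+1)).

Lemma dfn_ext R R' : (forall e, R e <-> R' e) -> dfn R -> dfn R'.
Proof. by move=> E [f [s [hs h]]]; exists f, s; split=> // e; rewrite -E. Qed.

Lemma dfn_not R : dfn R -> dfn (fun e => ~ R e).
Proof.
by move=> [f [s [hs h]]]; exists (Not f), s; split=> // e /=; rewrite h.
Qed.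

Lemma dfn_and P Q : dfn P -> dfn Q -> dfn (fun e => P e /\ Q e).
Proof.
move=> [f [s [hs h]]] [g [t [ht h']]].
exists (And (fsubst (fun k => Var k.*2) f) (fsubst (fun k => Var k.*2.+1) g)).
exists (fun k => if odd k then t k./2 else s k./2); split.
  by move=> k c; case: ifP => _; [apply: ht | apply: hs].
move=> e /=; rewrite !sat_fsubst h h' /=.
have -> : (fun k => slot e (if odd k.*2 then t k.*2./2 else s k.*2./2)) =
          (fun k => slot e (s k)).
  by apply/funext => k; rewrite odd_double doubleK.
have -> // : (fun k => slot e (if ~~ odd k.*2 then t (uphalf k.*2)
                               else s (uphalf k.*2))) =
          (fun k => slot e (t k)).
by apply/funext => k; rewrite odd_double uphalf_double.
Qed.

Lemma dfn_or P Q : dfn P -> dfn Q -> dfn (fun e => P e \/ Q e).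
Proof.
move=> hP hQ; apply: (@dfn_ext (fun e => ~ (~ P e /\ ~ Q e))).
  by move=> e; rewrite not_andP !notK.
by apply: dfn_not; apply: dfn_and; apply: dfn_not.
Qed.

Lemma dfn_imp P Q : dfn P -> dfn Q -> dfn (fun e => P e -> Q e).
Proof.
move=> hP hQ; apply: (@dfn_ext (fun e => ~ (P e /\ ~ Q e))).
  by move=> e; split=> [h p | h [p nq]]; [apply: contrapT => q; apply: h
                                        | apply: nq; apply: h].
by apply: dfn_not; apply: dfn_and => //; apply: dfn_not.
Qed.

Lemma dfn_ex (B : M -> (nat -> M) -> Prop) :
  dfn (fun e => B (e 0) (fun k => e k.+1)) -> dfn (fun e => exists x, B x e).
Proof.
move=> [f [s [hs h]]].
exists (Ex (fsubst (fun k => Var (if s k is inl 0 then 0 else k.+1)) f)).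
exists (fun k => match s k with
                 | inl i => inl i.-1 | inr c => inr c end); split.
  by move=> k c; case E: (s k) => [//|d] [<-]; apply: hs E.
move=> e /=.
have E x : B x e <-> sat (scons x (fun k => slot e
    match s k with inl i => inl i.-1 | inr c => inr c end))
    (fsubst (fun k => Var (if s k is inl 0 then 0 else k.+1)) f).
  rewrite sat_fsubst (h (scons x e)) /=.
  have -> // : (fun k => slot (scons x e) (s k)) =
     (fun k => scons x (fun k0 => slot e match s k0 with
                         | inl i => inl i.-1 | inr c => inr c end)
                 (if s k is inl 0 then 0 else k.+1)).
  by apply/funext => k; case E: (s k) => [[|i]|c] //=; rewrite E.
by split=> -[x hx]; exists x; apply/E.
Qed.

Lemma dfn_all (B : M -> (nat -> M) -> Prop) :
  dfn (fun e => B (e 0) (fun k => e k.+1)) -> dfn (fun e => forall x, B x e).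
Proof.
move=> hB; apply: (@dfn_ext (fun e => ~ exists x, ~ B x e)).
  by move=> e; split=> [h x|h [x]]; [apply: contrapT => hx; apply: h; exists x
                                     | apply].
by apply: dfn_not; apply: dfn_ex; apply: dfn_not.
Qed.

Lemma dfn_slot R (t : nat -> nat + M) :
  (forall k c, t k = inr c -> A c) -> dfn R ->
  dfn (fun e => R (fun k => slot e (t k))).
Proof.
move=> ht [f [s [hs h]]].
exists f, (fun k => match s k with inl i => t i | inr c => inr c end); split.
  by move=> k c; case E: (s k) => [i|d]; [apply: ht | move=> [<-]; apply: hs E].
move=> e; rewrite h; have -> // : (fun k => slot (fun k0 => slot e (t k0)) (s k))
  = (fun k => slot e match s k with inl i => t i | inr c => inr c end).
by apply/funext => k; case: (s k).
Qed.

Lemma dfn_sat0 f : dfn (fun e => sat e f).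
Proof. by exists f, inl; split. Qed.

Lemma dff_var k : dff (fun e => e k).
Proof. exact: (dfn_sat0 (Eq (Var 0) (Var k.+1))). Qed.

Lemma dff_const c : A c -> dff (fun=> c).
Proof.
move=> Ac; pose t k : nat + M := if k == 1 then inr c else inl k.
apply: (@dfn_slot (fun e => e 0 = e 1) t); last first.
  exact: (dfn_sat0 (Eq (Var 0) (Var 1))).
by move=> k d; rewrite /t; case: eqP => // _ [<-].
Qed.

Lemma dff_zero : dff (fun=> 0%A).
Proof. exact: (dfn_sat0 (Eq (Var 0) Zero)). Qed.

Lemma dff_one : dff (fun=> 1%A).
Proof. exact: (dfn_sat0 (Eq (Var 0) One)). Qed.

Lemma dff_shift F : dff F -> dff (fun e => F (fun k => e k.+1)).
Proof.
move=> hF; pose t k : nat + M := if k is k'.+1 then inl k'.+2 else inl 0.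
by apply: dfn_ext (dfn_slot (t := t) _ hF) => // -[].
Qed.

Lemma dfn_shift R : dfn R -> dfn (fun e => R (fun k => e k.+1)).
Proof. by move=> hR; apply: dfn_ext (dfn_slot (t := fun k => inl k.+1) _ hR). Qed.

(* A binary atom applied to definable functions: the values are named first. *)
Let dfn_rel2 (r : M -> M -> Prop) F G :
  dfn (fun e => r (e 1) (e 0)) -> dff F -> dff G -> dfn (fun e => r (F e) (G e)).
Proof.
move=> hr hF hG.
apply: (@dfn_ext (fun e => exists x, x = F e /\ exists y, y = G e /\ r x y)).
  by move=> e; split=> [[x [-> [y [->]]]]//|h]; exists (F e); split=> //;
    exists (G e).
apply: dfn_ex; apply: dfn_and => //; apply: dfn_ex; apply: dfn_and => //.
exact: (dff_shift hG).
Qed.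

Lemma dfn_eq F G : dff F -> dff G -> dfn (fun e => F e = G e).
Proof. by apply: dfn_rel2; apply: (dfn_sat0 (Eq (Var 1) (Var 0))). Qed.

Lemma dfn_le F G : dff F -> dff G -> dfn (fun e => F e <= G e)%A.
Proof. by apply: dfn_rel2; apply: (dfn_sat0 (Le (Var 1) (Var 0))). Qed.

Let dff_op2 (op : M -> M -> M) F G :
  dfn (fun e => e 2 = op (e 1) (e 0)) -> dff F -> dff G ->
  dff (fun e => op (F e) (G e)).
Proof.
move=> hop hF hG.
apply: (@dfn_ext (fun e => exists x, x = F (fun k => e k.+1) /\
   exists y, y = G (fun k => e k.+1) /\ e 0 = op x y)).
  move=> e; split=> [[x [-> [y [->]]]]//|h]; exists (F (fun k => e k.+1)).
  by split=> //; exists (G (fun k => e k.+1)).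
apply: dfn_ex; apply: dfn_and; first exact: (dff_shift hF).
apply: dfn_ex; apply: dfn_and => //; exact: (dff_shift (dff_shift hG)).
Qed.

Lemma dff_add F G : dff F -> dff G -> dff (fun e => F e + G e)%A.
Proof. by apply: dff_op2; apply: (dfn_sat0 (Eq (Var 2) (Add (Var 1) (Var 0)))). Qed.

Lemma dff_mul F G : dff F -> dff G -> dff (fun e => F e * G e)%A.
Proof. by apply: dff_op2; apply: (dfn_sat0 (Eq (Var 2) (Mul (Var 1) (Var 0)))). Qed.

Lemma dff_eval G t : (forall k, dff (G k)) -> dff (fun e => eval (G^~ e) t).
Proof.
move=> hG; elim: t => /=; [exact: hG|exact: dff_zero|exact: dff_one| |].
- by move=> t1 h1 t2 h2; apply: dff_add.
- by move=> t1 h1 t2 h2; apply: dff_mul.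
Qed.

Definition lift_env (G : nat -> (nat -> M) -> M) : nat -> (nat -> M) -> M :=
  fun k => if k is k'.+1 then fun e => G k' (fun i => e i.+1) else fun e => e 0.

Lemma dff_lift_env G : (forall k, dff (G k)) -> forall k, dff (lift_env G k).
Proof. by move=> hG [|k] /=; [apply: dff_var | apply: dff_shift]. Qed.

(** Induction on the formula works because definable functions are closed under the
    shift of the environment that a quantifier causes. *)
Lemma dfn_sat G f : (forall k, dff (G k)) -> dfn (fun e => sat (G^~ e) f).
Proof.
elim: f G => /=.
- by move=> t1 t2 G hG; apply: dfn_eq; apply: dff_eval.
- by move=> t1 t2 G hG; apply: dfn_le; apply: dff_eval.
- by move=> f IH G hG; apply: dfn_not; apply: IH.
- by move=> f IHf g IHg G hG; apply: dfn_and; [apply: IHf|apply: IHg].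
- by move=> f IHf g IHg G hG; apply: dfn_or; [apply: IHf|apply: IHg].
- by move=> f IHf g IHg G hG; apply: dfn_imp; [apply: IHf|apply: IHg].
- move=> f IH G hG; apply: dfn_all.
  apply: dfn_ext (IH _ (dff_lift_env hG)) => e.
  by rewrite (_ : (fun k => lift_env G k e) = scons (e 0) (fun k => G k (fun i => e i.+1)))
     //; apply/funext => -[].
- move=> f IH G hG; apply: dfn_ex.
  apply: dfn_ext (IH _ (dff_lift_env hG)) => e.
  by rewrite (_ : (fun k => lift_env G k e) = scons (e 0) (fun k => G k (fun i => e i.+1)))
     //; apply/funext => -[].
Qed.

Lemma dfn_comp R G : dfn R -> (forall k, dff (G k)) -> dfn (fun e => R (G^~ e)).
Proof.
move=> [f [s [hs h]]] hG.
pose G' k := match s k with inl i => G i | inr c => fun=> c end.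
apply: (@dfn_ext (fun e => sat (G'^~ e) f)) => [e|].
  rewrite h; have -> // : (fun k => slot (G^~ e) (s k)) = G'^~ e.
  by apply/funext => k; rewrite /G'; case: (s k).
apply: dfn_sat => k; rewrite /G'; case E: (s k) => [i|c] //.
exact: dff_const (hs _ _ E).
Qed.

Lemma dff_comp H G : dff H -> (forall k, dff (G k)) -> dff (fun e => H (G^~ e)).
Proof.
by move=> hH hG; apply: dfn_ext (dfn_comp hH (dff_lift_env hG)) => e.
Qed.

Definition dpred (P : M -> Prop) := dfn (fun e => P (e 0)).
Definition drel (R : M -> M -> Prop) := dfn (fun e => R (e 0) (e 1)).
Definition dfun (F : M -> M) := dff (fun e => F (e 0)).
Definition dfun2 (F : M -> M -> M) := dff (fun e => F (e 0) (e 1)).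

Lemma dfn_app1 P F : dpred P -> dff F -> dfn (fun e => P (F e)).
Proof.
move=> hP hF; exact: (@dfn_comp _ (fun k => F) hP).
Qed.

Lemma dfn_app2 R F G : drel R -> dff F -> dff G -> dfn (fun e => R (F e) (G e)).
Proof.
move=> hP hF hG; apply: (@dfn_comp _ (fun k => if k is 0 then F else G) hP).
by case.
Qed.

Lemma dff_app1 H F : dfun H -> dff F -> dff (fun e => H (F e)).
Proof.
move=> hP hF; exact: (@dff_comp _ (fun k => F) hP).
Qed.

Lemma dff_app2 H F G : dfun2 H -> dff F -> dff G -> dff (fun e => H (F e) (G e)).
Proof.
move=> hP hF hG; apply: (@dff_comp _ (fun k => if k is 0 then F else G) hP).
by case.
Qed.

(** The shape required by [formula_over]: the variables from [n] on name parameters,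
    so a variable of the relation beyond the arguments becomes the parameter 0. *)
Lemma dfn_formula R n : A 0%A -> dfn R ->
  exists (f : formula) (e : nat -> M), (forall k, A (e k)) /\
    forall xs : seq M, size xs = n ->
      R (foldr (@scons M) (fun=> 0%A) xs) <-> sat (foldr (@scons M) e xs) f.
Proof.
move=> A0 [f [s [hs h]]].
pose r k := match s k with inl i => if i < n then i else n + k | inr c => n + k end.
exists (fsubst (fun k => Var (r k)) f).
exists (fun k => if s k is inr c then c else 0%A); split.
  by move=> k; case E: (s k) => [i|c] //; apply: hs E.
move=> xs sz; rewrite h sat_fsubst /=.
have -> // : (fun k => slot (foldr (@scons M) (fun=> 0%A) xs) (s k)) =
  (fun k => foldr (@scons M) (fun k0 => if s k0 is inr c then c else 0%A) xs (r k)).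
apply/funext => k; rewrite /r; case E: (s k) => [i|c] /=.
  case: ltnP => [hi|hi]; first by apply: foldr_scons_lt; rewrite sz.
  by rewrite -sz foldr_scons_ge E -(subnKC hi) -sz foldr_scons_ge.
by rewrite -sz foldr_scons_ge E.
Qed.

End Definable.

Local Open Scope arith_scope.

(* [dfn_auto] proves definability by following the syntax of a relation; [dfn_hook]
   is extended whenever new definable functions have been introduced. *)
Ltac dfn_hook := fail.

Ltac dfn_step :=
  cbv beta;
  first
    [ assumption
    | dfn_hook
    | lazymatch goal with
      | |- dff _ _ =>
        first
        [ apply: dff_var
        | apply: dff_const; solve [exact: I | assumption]
        | apply: dff_zero | apply: dff_one
        | match goal with H : dfun _ _ |- _ => apply: (dff_app1 H) end
        | match goal with H : dfun2 _ _ |- _ => apply: (dff_app2 H) end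
        | apply: dff_add | apply: dff_mul ]
      | |- dfn _ _ =>
        first
        [ match goal with H : dpred _ _ |- _ => apply: (dfn_app1 H) end
        | match goal with H : drel _ _ |- _ => apply: (dfn_app2 H) end
        | apply: dfn_eq | apply: dfn_le
        | apply: dfn_and | apply: dfn_or | apply: dfn_not
        | apply: dfn_ex | apply: dfn_all | apply: dfn_imp ]
      end ].

Ltac dfn_auto :=
  cbv delta [dpred drel dfun dfun2]; repeat dfn_step.

(** * Arithmetic in a model of Peano arithmetic *)

(** A class, so that the arithmetic lemmas find the hypothesis on the model
    themselves. *)
Class PA_model (M : arith_structure) : Prop := PA_modelP : models M PA.

Section PA.
Context (M : arith_structure) {HM : PA_model M}.
Implicit Types x y z : M.
Notation dpredT := (@dpred M setT).

Lemma PA_ind (P : M -> Prop) : dpredT P -> P 0 ->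
  (forall x, P x -> P (x + 1)) -> forall x, P x.
Proof.
move=> hP P0 PS.
have [f [e [_ h]]] := dfn_formula 1 (A := setT) I hP.
have E x : P x <-> sat (scons x e) f by exact: (h [:: x]).
have := HM (PA_induction f) e; rewrite /= sat_fsubst /=.
have -> : (fun k => eval e (scons Zero Var k)) = scons 0 e by apply/funext => -[].
move=> H x; apply/E; apply: H => [|y hy]; first exact/E.
rewrite sat_fsubst /=.
have -> : (fun k => eval (scons y e) (scons (Add (Var 0) One)
   (fun k0 => Var k0.+1) k)) = scons (y + 1) e by apply/funext => -[].
by apply/E; apply: PS; apply/E.
Qed.

Lemma succ_neq0 x : x + 1 <> 0.
Proof. exact: (HM PA_succ_neq0 (fun=> x)). Qed.
Lemma succ_inj x y : x + 1 = y + 1 -> x = y.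
Proof. exact: (HM PA_succ_inj (scons x (fun=> y))). Qed.
Lemma adda0 x : x + 0 = x.
Proof. exact: (HM PA_add0 (fun=> x)). Qed.
Lemma addaS x y : x + (y + 1) = x + y + 1.
Proof. exact: (HM PA_addS (scons x (fun=> y))). Qed.
Lemma mula0 x : x * 0 = 0.
Proof. exact: (HM PA_mul0 (fun=> x)). Qed.
Lemma mulaS x y : x * (y + 1) = x * y + x.
Proof. exact: (HM PA_mulS (scons x (fun=> y))). Qed.
Lemma le_ex x y : x <= y <-> exists z, x + z = y.
Proof.
split; first exact: (HM PA_le_add (scons x (fun=> y))).
exact: (HM PA_add_le (scons x (fun=> y))).
Qed.

Lemma add0a x : 0 + x = x.
Proof.
by move: x; apply: PA_ind => [||x IH]; [dfn_auto|rewrite adda0|rewrite addaS IH].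
Qed.
Lemma addaA x y z : x + (y + z) = x + y + z.
Proof.
move: z; apply: PA_ind => [||z IH]; first by dfn_auto.
- by rewrite !adda0.
- by rewrite !addaS IH.
Qed.
Lemma addSa x y : x + 1 + y = x + y + 1.
Proof.
move: y; apply: PA_ind => [||y IH]; first by dfn_auto.
- by rewrite !adda0.
- by rewrite !addaS IH.
Qed.
Lemma addaC x y : x + y = y + x.
Proof.
move: y; apply: PA_ind => [||y IH]; first by dfn_auto.
- by rewrite adda0 add0a.
- by rewrite addaS IH addSa.
Qed.
Lemma mul0a x : 0 * x = 0.
Proof.
move: x; apply: PA_ind => [||x IH]; first by dfn_auto.
- by rewrite mula0.
- by rewrite mulaS IH adda0.
Qed.
Lemma mulSa x y : (x + 1) * y = x * y + y.
Proof.
move: y; apply: PA_ind => [||y IH]; first by dfn_auto.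
- by rewrite !mula0 adda0.
- rewrite !mulaS IH -!addaA; congr (_ + _); rewrite !addaA; congr (_ + _).
  exact: addaC.
Qed.
Lemma mulaC x y : x * y = y * x.
Proof.
move: y; apply: PA_ind => [||y IH]; first by dfn_auto.
- by rewrite mula0 mul0a.
- by rewrite mulaS IH mulSa.
Qed.
Lemma mulaDr x y z : x * (y + z) = x * y + x * z.
Proof.
move: z; apply: PA_ind => [||z IH]; first by dfn_auto.
- by rewrite mula0 !adda0.
- by rewrite addaA !mulaS IH addaA.
Qed.
Lemma mulaA x y z : x * (y * z) = x * y * z.
Proof.
move: z; apply: PA_ind => [||z IH]; first by dfn_auto.
- by rewrite !mula0.
- by rewrite !mulaS mulaDr IH.
Qed.
Lemma mul1a x : 1 * x = x.
Proof. by rewrite -(add0a 1) mulSa mul0a add0a. Qed.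

Lemma PA_srt : semi_ring_theory (R := M) 0 1 (@ar_add M) (@ar_mul M) eq.
Proof.
split=> *; rewrite ?add0a ?mul1a ?mul0a //.
- exact: addaC. - exact: addaA. - exact: mulaC. - exact: mulaA.
- by rewrite mulaC mulaDr; congr (_ + _); apply: mulaC.
Qed.
Add Ring PA_ring : PA_srt.

Lemma addIa x y z : x + z = y + z -> x = y.
Proof.
move: z; apply: PA_ind => [||z IH]; first by dfn_auto.
- by rewrite !adda0.
- by rewrite !addaS => /succ_inj.
Qed.
Lemma addaI x y z : x + y = x + z -> y = z.
Proof. by rewrite !(addaC x); apply: addIa. Qed.

Lemma zero_or_succ x : x = 0 \/ exists y, x = y + 1.
Proof.
move: x; apply: PA_ind => [||x IH]; first by dfn_auto.
- by left.
- by right; exists x.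
Qed.
Lemma add_succ_neq x y : x + y + 1 <> x.
Proof.
move=> h; apply: (@succ_neq0 y); apply: (@addaI x).
by rewrite adda0 addaA.
Qed.

Lemma lt_ex x y : x < y <-> exists z, y = x + z + 1.
Proof.
split=> [[/le_ex[z <-] ne]|[z ->]].
  case: (zero_or_succ z) => [z0|[w ->]]; last by exists w; rewrite addaA.
  by case: ne; rewrite z0 adda0.
split; first by apply/le_ex; exists (z + 1); rewrite addaA.
by move=> /esym/add_succ_neq.
Qed.

Lemma lea_refl x : x <= x.
Proof. by apply/le_ex; exists 0; rewrite adda0. Qed.
Hint Resolve lea_refl : core.
Lemma lea_trans y x z : x <= y -> y <= z -> x <= z.
Proof.
by move=> /le_ex[u <-] /le_ex[v <-]; apply/le_ex; exists (u + v); ring.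
Qed.
Lemma lta_irr x : ~ x < x.
Proof. by case. Qed.
Lemma leNgt_a x y : x <= y <-> ~ y < x.
Proof.
split=> [/le_ex[z <-] /lt_ex[w]|].
  have -> : x + z + w + 1 = x + (z + w) + 1 by ring.
  by move/esym/add_succ_neq.
move: y; apply: PA_ind => [||y IH h]; first by rewrite /ar_lt; dfn_auto.
  case: (zero_or_succ x) => [->//|[z ->]] []; apply/lt_ex; exists z; ring.
case: (pselect (x <= y)) => [/le_ex[z <-]|h'].
  by apply/le_ex; exists (z + 1); ring.
have {}h' : y < x by apply: contrapT => /IH.
move/lt_ex: h' => [z E]; case: (zero_or_succ z) => [z0|[w Ew]].
  by rewrite E z0 adda0.
by case: h; apply/lt_ex; exists w; rewrite E Ew; ring.
Qed.
Lemma ltNge_a x y : x < y <-> ~ y <= x.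
Proof. by rewrite leNgt_a notK. Qed.
Lemma lta_total x y : x < y \/ y <= x.
Proof. by rewrite leNgt_a; case: (pselect (x < y)); [left|right]. Qed.
Lemma ltaW x y : x < y -> x <= y.
Proof. by case. Qed.
Lemma lea_anti x y : x <= y -> y <= x -> x = y.
Proof. by move=> h /leNgt_a h'; apply: contrapT => ne; apply: h'. Qed.
Lemma lea_lt x y : x <= y -> x < y \/ x = y.
Proof. by move=> h; case: (pselect (x = y)) => [->|ne]; [right|left]. Qed.
Lemma lta_le_trans y x z : x < y -> y <= z -> x < z.
Proof.
move=> h h'; apply/ltNge_a => h''; move/ltNge_a: h; apply.
exact: lea_trans h' h''.
Qed.
Lemma lea_lt_trans y x z : x <= y -> y < z -> x < z.
Proof.
move=> h h'; apply/ltNge_a => h''; move/ltNge_a: h'; apply.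
exact: lea_trans h'' h.
Qed.
Lemma lta_trans y x z : x < y -> y < z -> x < z.
Proof. by move=> h /ltaW; apply: lta_le_trans. Qed.
Lemma lt0a x : 0 < x + 1.
Proof. by apply/lt_ex; exists x; rewrite add0a. Qed.
Lemma le0a x : 0 <= x.
Proof. by apply/le_ex; exists x; rewrite add0a. Qed.
Hint Resolve lt0a le0a : core.
Lemma nlt0a x : ~ x < 0.
Proof. by apply/leNgt_a. Qed.
Lemma lea0 x : x <= 0 -> x = 0.
Proof. by move=> h; apply: lea_anti. Qed.
Lemma ltaSle x y : x < y + 1 <-> x <= y.
Proof.
split=> [/lt_ex[z]|/le_ex[z <-]]; last by apply/lt_ex; exists z.
by move/succ_inj ->; apply/le_ex; exists z.
Qed.
Lemma leSlt_a x y : x + 1 <= y <-> x < y.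
Proof.
split=> [/le_ex[z <-]|/lt_ex[z ->]]; [apply/lt_ex|apply/le_ex]; exists z; ring.
Qed.
Lemma ltaS x : x < x + 1.
Proof. by apply/ltaSle. Qed.
Lemma leaS x : x <= x + 1.
Proof. exact: ltaW (ltaS x). Qed.
Hint Resolve ltaS leaS : core.
Lemma ltaSS x y : x + 1 < y + 1 <-> x < y.
Proof. by rewrite ltaSle leSlt_a. Qed.
Lemma leaD x y z t : x <= y -> z <= t -> x + z <= y + t.
Proof.
by move=> /le_ex[u <-] /le_ex[v <-]; apply/le_ex; exists (u + v); ring.
Qed.
Lemma ltaD x y z t : x < y -> z <= t -> x + z < y + t.
Proof.
by move=> /lt_ex[u ->] /le_ex[v <-]; apply/lt_ex; exists (u + v); ring.
Qed.
Lemma leaM x y z t : x <= y -> z <= t -> x * z <= y * t.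
Proof.
move=> /le_ex[u <-] /le_ex[v <-]; apply/le_ex.
by exists (x * v + u * z + u * v); ring.
Qed.
Lemma lea_addr x y : x <= x + y.
Proof. by apply/le_ex; exists y. Qed.
Lemma lea_addl x y : x <= y + x.
Proof. by apply/le_ex; exists y; ring. Qed.
Hint Resolve lea_addr lea_addl : core.
Lemma leaD2l x y z : x + y <= x + z <-> y <= z.
Proof.
split=> [/le_ex[w h]|h]; last exact: leaD.
by apply/le_ex; exists w; apply: (@addaI x); rewrite addaA.
Qed.
Lemma ltaD2l x y z : x + y < x + z <-> y < z.
Proof. by rewrite -!leSlt_a -addaA leaD2l. Qed.
Lemma gt0_succ x : 0 < x -> exists y, x = y + 1.
Proof. by move=> /lt_ex[z ->]; exists z; ring. Qed.
Lemma gt0M x y : 0 < x -> 0 < y -> 0 < x * y.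
Proof.
move=> /gt0_succ[u ->] /gt0_succ[v ->]; apply/lt_ex.
by exists (u * v + u + v); ring.
Qed.
Lemma lea_mulr x y : 0 < y -> x <= x * y.
Proof. by move=> /gt0_succ[u ->]; apply/le_ex; exists (x * u); ring. Qed.
Lemma gt0_neq0 x : 0 < x -> x <> 0.
Proof. by move=> h E; move: h; rewrite E => /lta_irr. Qed.
Lemma lt01 : (0 : M) < 1.
Proof. by rewrite -(add0a 1). Qed.

Lemma strong_ind (P : M -> Prop) : dpredT P ->
  (forall x, (forall y, y < x -> P y) -> P x) -> forall x, P x.
Proof.
move=> hP H x.
suff : forall y, y <= x -> P y by apply.
move: x; apply: PA_ind => [||x IH].
- by dfn_auto.
- by move=> y /lea0 ->; apply: H => z /nlt0a.
move=> y /lea_lt[/ltaSle/IH//|->]; apply: H => z /ltaSle; exact: IH.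
Qed.

(** Least elements provide definable Skolem functions.  Quotients, remainders,
    projections and powers are all introduced in this way, so that their
    definability is a consequence of that of their specification. *)
Definition least (P : M -> Prop) x := P x /\ forall y, P y -> x <= y.
Definition mu (P : M -> Prop) : M :=
  if pselect (exists x, least P x) is left h then projT1 (cid h) else 0.

Lemma least_uniq P x y : least P x -> least P y -> x = y.
Proof.
by move=> [hx hx'] [hy hy']; apply: lea_anti; [apply: hx'|apply: hy'].
Qed.
Lemma mu_leastE P x : least P x -> mu P = x.
Proof.
rewrite /mu => h; case: pselect => [h'|[]]; last by exists x.
by case: cid => y hy /=; apply: least_uniq hy h.
Qed.
Lemma mu_noleast P : ~ (exists x, least P x) -> mu P = 0.
Proof. by rewrite /mu; case: pselect. Qed.

Lemma mu_least (P : M -> Prop) x : dpredT P -> P x ->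
  P (mu P) /\ forall y, P y -> mu P <= y.
Proof.
move=> hP Px.
have [z hz] : exists z, P z /\ forall y, P y -> z <= y.
  apply: contrapT => nz.
  have H y : ~ P y.
    move: y; apply: strong_ind => [|y IH Py]; first by dfn_auto.
    apply: nz; exists y; split=> // z Pz; apply/leNgt_a => h; exact: IH h Pz.
  exact: (H x).
by rewrite (mu_leastE hz).
Qed.
Lemma muP (P : M -> Prop) x : dpredT P -> P x -> P (mu P).
Proof. by move=> hP /(mu_least hP)[]. Qed.
Lemma mu_eq (P : M -> Prop) x : (forall y, P y <-> y = x) -> mu P = x.
Proof.
move=> h; have hP : dpredT P.
  rewrite /dpred; apply: (@dfn_ext M _ (fun e : nat -> M => e 0%N = x)) => [e|].
    by rewrite h.
  by dfn_auto.
by apply/h; apply: (muP hP (x := x)); apply/h.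
Qed.

Lemma dff_mu (A : set M) (B : M -> (nat -> M) -> Prop) :
  dfn A (fun e => B (e 0%N) (fun k => e k.+1)) -> dff A (fun e => mu (fun x => B x e)).
Proof.
move=> hB.
pose L x e := B x e /\ forall y, B y e -> x <= y.
have hL : dfn A (fun e => L (e 0%N) (fun k => e k.+1)).
  rewrite /L; apply: dfn_and => //; apply: dfn_all; apply: dfn_imp; last by dfn_auto.
  by apply: dfn_ext (dfn_slot (t := fun k => inl (if k is 0%N then 0%N else k.+1)) _ hB).
apply: (@dfn_ext M _ (fun e : nat -> M => L (e 0%N) (fun k => e k.+1) \/
   (~ (exists x, L x (fun k => e k.+1))) /\ e 0%N = 0)).
  move=> e; split=> [[h|[h ->]]|->].
  - by rewrite (mu_leastE h).
  - by rewrite mu_noleast.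
  - case: (pselect (exists x, L x (fun k => e k.+1))) => [[x Lx]|nL].
      by left; rewrite (mu_leastE Lx).
    by right; split=> //; rewrite mu_noleast.
apply: dfn_or => //; apply: dfn_and; last by dfn_auto.
apply: dfn_not; apply: dfn_ex.
exact: dfn_ext (dfn_slot (t := fun k => inl (if k is 0%N then 0%N else k.+1)) _ hL).
Qed.

End PA.
Arguments lt01 {M HM}.

#[export] Hint Extern 0 (ar_le _ _) => solve
  [apply: lea_refl|apply: le0a|apply: leaS|apply: lea_addr|apply: lea_addl] : core.
#[export] Hint Extern 0 (ar_lt _ _) => solve [apply: lt0a|apply: ltaS|apply: lt01] : core.

(** * Division and Goedel's beta function *)

Section Coding.
Context (M : arith_structure) {HM : PA_model M}.
Implicit Types a b x y z c d m q r u : M.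
Add Ring PA_ring : (PA_srt (M := M)).
Notation dpredT := (@dpred M setT).
Notation dfunT := (@dfun M setT).

Lemma dfn_lt (A : set M) F G : dff A F -> dff A G -> dfn A (fun e => F e < G e).
Proof. by move=> hF hG; rewrite /ar_lt; dfn_auto. Qed.

Definition modA c m : M := mu (fun r => r < m /\ exists q, c = q * m + r).
Definition divA c m : M := mu (fun q => exists r, r < m /\ c = q * m + r).

Lemma div_ex c m : 0 < m -> exists q r, r < m /\ c = q * m + r.
Proof.
move=> m0; move: c; apply: PA_ind => [||c [q [r [rm ->]]]].
- by rewrite /ar_lt; dfn_auto.
- by exists 0, 0; split=> //; ring.
move/leSlt_a/lea_lt: rm => [rm|<-].
- by exists q, (r + 1); split=> //; ring.
- by exists (q + 1), 0; split=> //; ring.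
Qed.

Let div_uniq_le m q r q' r' : r < m -> q * m + r = q' * m + r' -> q' <= q.
Proof.
move=> rm E; apply/leNgt_a => /lt_ex[z Ez]; move: E; rewrite Ez.
have -> : (q + z + 1) * m + r' = q * m + (z * m + m + r') by ring.
move/addaI=> E; move/ltNge_a: rm; apply; rewrite E.
by apply/le_ex; exists (z * m + r'); ring.
Qed.

Lemma div_uniq m q r q' r' : r < m -> r' < m ->
  q * m + r = q' * m + r' -> q = q' /\ r = r'.
Proof.
move=> rm rm' E.
have Eq : q = q' by apply: lea_anti; [apply: div_uniq_le (esym E)|apply: div_uniq_le E].
by split=> //; move: E; rewrite Eq => /addaI.
Qed.

Lemma modA_eq c m q r : r < m -> c = q * m + r -> modA c m = r.
Proof.
move=> rm ->; apply: mu_eq => y; split=> [[ym [q' /(div_uniq rm ym)[]//]]|->].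
by split=> //; exists q.
Qed.
Lemma divA_eq c m q r : r < m -> c = q * m + r -> divA c m = q.
Proof.
move=> rm ->; apply: mu_eq => y; split=> [[r' [ym /(div_uniq rm ym)[]//]]|->].
by exists r.
Qed.
Lemma modA_lt c m : 0 < m -> modA c m < m.
Proof. by move=> /(div_ex c)[q [r [rm h]]]; rewrite (modA_eq rm h). Qed.
Lemma divA_mod c m : 0 < m -> c = divA c m * m + modA c m.
Proof.
by move=> /(div_ex c)[q [r [rm h]]]; rewrite (modA_eq rm h) (divA_eq rm h).
Qed.

Lemma dff_mod (A : set M) F G : dff A F -> dff A G -> dff A (fun e => modA (F e) (G e)).
Proof.
apply: dff_app2; rewrite /dfun2; apply: dff_mu.
by rewrite /ar_lt; dfn_auto.
Qed.
Lemma dff_div (A : set M) F G : dff A F -> dff A G -> dff A (fun e => divA (F e) (G e)).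
Proof.
apply: dff_app2; rewrite /dfun2; apply: dff_mu.
by rewrite /ar_lt; dfn_auto.
Qed.

Ltac dfn_hook ::= first [apply: dfn_lt | apply: dff_mod | apply: dff_div].

Definition modulus d i := 1 + (i + 1) * d.

Lemma modulus_gt0 d i : 0 < modulus d i.
Proof. by rewrite /modulus addaC. Qed.
Hint Resolve modulus_gt0 : core.

Lemma beta_mod c d i u : beta c d i u <-> modA c (modulus d i) = u.
Proof.
split=> [[um [q h]]|<-]; first exact: modA_eq um h.
split; first exact: modA_lt.
exists (divA c (modulus d i)); exact: divA_mod.
Qed.

Definition coprimeA x y := exists u v, x * u = y * v + 1.

Lemma coprimeA_mull x y z : coprimeA x z -> coprimeA y z -> coprimeA (x * y) z.
Proof.
move=> [u [v h]] [w [t h']]; exists (u * w), (v * z * t + v + t).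
have -> : x * y * (u * w) = x * u * (y * w) by ring.
by rewrite h h'; ring.
Qed.

Lemma coprimeA_opp x y u v : 0 < x -> x * u + 1 = y * v -> coprimeA x y.
Proof.
move=> x0 h; case: (zero_or_succ (x * u)) => [h0|[b hb]].
  have {}h : y * v = 1 by rewrite -h h0 add0a.
  have [w ->] := gt0_succ x0; exists 1, (v * w).
  by rewrite mulaA h; ring.
exists (u * x * u), (b * v).
have -> : y * (b * v) = b * (y * v) by ring.
have -> : x * (u * x * u) = x * u * (x * u) by ring.
by rewrite -h hb; ring.
Qed.

(** The moduli of the beta function are pairwise coprime once [d] is divisible by
    the differences of the indices: with [k = i + t] and [d = t * d'], the number
    [- (k+1)^2 d'] inverts the [i]-th modulus modulo the [k]-th. *)
Lemma coprime_modulus d i k t d' : k = i + t -> d = t * d' ->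
  coprimeA (modulus d i) (modulus d k).
Proof.
move=> -> ->.
apply: (@coprimeA_opp _ _ ((i + t + 1) * (i + t + 1) * d')
          ((i + 1) * d' * (i + t + 1) + 1)) => //.
by rewrite /modulus; ring.
Qed.

Lemma dfun_bounded (F : M -> M) n : dfunT F -> exists b, forall i, i < n -> F i <= b.
Proof.
move=> hF; move: n; apply: PA_ind => [||n [b hb]]; first by dfn_auto.
- by exists 0 => i /nlt0a.
exists (b + F n) => i /ltaSle/lea_lt[/hb h|-> //].
exact: lea_trans h _.
Qed.

Lemma common_multiple n : exists d, 0 < d /\
  forall t, 0 < t -> t <= n -> exists d', d = t * d'.
Proof.
move: n; apply: PA_ind => [||n [d [d0 hd]]]; first by dfn_auto.
- exists 1; split=> // t t0 /lea0 E; by move: t0; rewrite E => /lta_irr.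
exists (d * (n + 1)); split; first exact: gt0M.
move=> t t0 /lea_lt[/ltaSle/(hd _ t0)[d' ->]|->].
- by exists (d' * (n + 1)); ring.
- by exists d; ring.
Qed.

(** The Chinese remainder theorem, one modulus at a time; [p] is a common multiple
    of the moduli used so far. *)
Lemma beta_lemma (F : M -> M) n : dfunT F ->
  exists c d, forall i, i < n -> modA c (modulus d i) = F i.
Proof.
move=> hF.
have [b hb] := dfun_bounded n hF.
have [d0 [d0_gt0 hd0]] := common_multiple n.
pose d := d0 * (b + 1).
suff H m : m <= n -> exists c p,
    (forall i, i < m -> modA c (modulus d i) = F i) /\
    (forall i, i < m -> exists q, p = q * modulus d i) /\
    (forall k, m <= k -> k < n -> coprimeA p (modulus d k)).
  by have [c [p [h _]]] := H n (lea_refl n); exists c, d.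
move: m; apply: PA_ind => [||m IH hm].
- by rewrite /coprimeA /modulus; dfn_auto.
- move=> _; exists 0, 1; split; first by move=> i /nlt0a.
  split; first by move=> i /nlt0a.
  by move=> k _ _; exists 1, 0; ring.
have mn : m < n by apply/leSlt_a.
have [c [p [h1 [h2 h3]]]] := IH (ltaW mn).
have [u [v huv]] := h3 m (lea_refl m) mn.
have Ex : modulus d m = (m + 1) * d + 1 by rewrite /modulus; ring.
exists (c + p * (u * (F m + (m + 1) * d * c))), (p * modulus d m); split.
  move=> i /ltaSle/lea_lt[im|->].
    have [q hq] := h2 i im; have xi0 := modulus_gt0 d i.
    rewrite -(h1 i im); set x := modulus d i in hq xi0 *.
    apply: (@modA_eq _ _ (divA c x + q * (u * (F m + (m + 1) * d * c)))).
      exact: modA_lt.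
    by rewrite hq {1}(divA_mod c xi0); ring.
  apply: (@modA_eq _ _ (c + v * (F m + (m + 1) * d * c))).
    rewrite Ex; apply/ltaSle; apply: lea_trans (hb m mn) _.
    apply: (@lea_trans _ _ d).
      apply: lea_trans (leaS b) _; rewrite /d mulaC; exact: lea_mulr.
    rewrite mulaC; exact: lea_mulr.
  rewrite mulaA huv Ex; ring.
split.
  move=> i /ltaSle/lea_lt[im|->]; last by exists p.
  by have [q hq] := h2 i im; exists (q * modulus d m); rewrite hq; ring.
move=> k hk kn; have mk : m < k by apply/leSlt_a.
apply: coprimeA_mull; first by apply: h3 => //; apply: ltaW.
have /lt_ex[t Et] := mk.
have Ek : k = m + (t + 1) by rewrite Et addaA.
have tn : t + 1 <= n by apply: lea_trans (ltaW kn); rewrite Ek.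
have [d' Ed'] := hd0 _ (lt0a t) tn.
apply: (coprime_modulus Ek (d' := d' * (b + 1))); by rewrite /d Ed' mulaA.
Qed.

(** * Pairs and sequences *)

Definition pairA x y := (x + y) * (x + y) + x.

Let pairA_lt x y x' y' : x + y < x' + y' -> pairA x y < pairA x' y'.
Proof.
move=> /lt_ex[z E]; rewrite /pairA E; apply/lt_ex.
by exists (x * z + y * z + x * z + y * z + z * z + z + z + x + y + y + x'); ring.
Qed.

(** [(x + y)^2 + x] lies between [(x + y)^2] and the next square. *)
Lemma pairA_inj x y x' y' : pairA x y = pairA x' y' -> x = x' /\ y = y'.
Proof.
move=> E.
case: (lta_total (x + y) (x' + y')) => [/pairA_lt|/lea_lt[/pairA_lt|E']].
- by rewrite E => /lta_irr.
- by rewrite E => /lta_irr.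
move: E; rewrite /pairA E' => /addaI Ex; split=> //.
by move: E'; rewrite Ex => /addaI.
Qed.

Definition fstA p := mu (fun x => exists y, p = pairA x y).
Definition sndA p := mu (fun y => exists x, p = pairA x y).

Lemma fstA_pair x y : fstA (pairA x y) = x.
Proof.
by apply: mu_eq => z; split=> [[w /pairA_inj[-> _]]//|->]; exists y.
Qed.
Lemma sndA_pair x y : sndA (pairA x y) = y.
Proof.
by apply: mu_eq => z; split=> [[w /pairA_inj[_ ->]]//|->]; exists x.
Qed.
Lemma dff_pair (A : set M) F G : dff A F -> dff A G -> dff A (fun e => pairA (F e) (G e)).
Proof. by move=> hF hG; rewrite /pairA; dfn_auto. Qed.
Lemma dff_fst (A : set M) F : dff A F -> dff A (fun e => fstA (F e)).
Proof. apply: dff_app1; rewrite /dfun; apply: dff_mu; rewrite /pairA; dfn_auto. Qed.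
Lemma dff_snd (A : set M) F : dff A F -> dff A (fun e => sndA (F e)).
Proof. apply: dff_app1; rewrite /dfun; apply: dff_mu; rewrite /pairA; dfn_auto. Qed.

(** A sequence is coded by one number, the pair of the first two arguments of the
    beta function. *)
Definition at_ s i := modA (fstA s) (modulus (sndA s) i).

Lemma dff_at (A : set M) F G : dff A F -> dff A G -> dff A (fun e => at_ (F e) (G e)).
Proof.
move=> hF hG; rewrite /at_ /modulus.
have h := dff_fst hF; have h' := dff_snd hF; dfn_auto.
Qed.

Lemma seq_ex (F : M -> M) n : dfunT F -> exists s, forall i, i < n -> at_ s i = F i.
Proof.
move=> hF; have [c [d h]] := beta_lemma n hF.
by exists (pairA c d) => i ni; rewrite /at_ fstA_pair sndA_pair h.
Qed.

Ltac dfn_hook ::= first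
  [ apply: dfn_lt | apply: dff_mod | apply: dff_div | apply: dff_pair
  | apply: dff_fst | apply: dff_snd | apply: dff_at | apply: dff_mu ].

Definition ifA (P : Prop) x y := if pselect P is left _ then x else y.
Lemma ifT (P : Prop) x y : P -> ifA P x y = x.
Proof. by rewrite /ifA; case: pselect. Qed.
Lemma ifF (P : Prop) x y : ~ P -> ifA P x y = y.
Proof. by rewrite /ifA; case: pselect. Qed.
Lemma dff_if (A : set M) P F G : dfn A P -> dff A F -> dff A G ->
  dff A (fun e => ifA (P e) (F e) (G e)).
Proof.
move=> hP hF hG.
apply: (@dfn_ext M A (fun e => (P (fun k => e k.+1) /\ e 0%N = F (fun k => e k.+1))
  \/ (~ P (fun k => e k.+1) /\ e 0%N = G (fun k => e k.+1)))).
  move=> e; rewrite /ifA; case: pselect => h; split; try tauto.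
have hP' := dfn_shift hP; dfn_auto.
Qed.

(** * Powers of two *)

Notation "2" := (1 + 1) : arith_scope.

Lemma is_pow2E a b : is_pow2 a b <-> exists c d,
  modA c (modulus d 0) = 1 /\
  (forall i, i < a -> modA c (modulus d (i + 1)) = 2 * modA c (modulus d i)) /\
  modA c (modulus d a) = b.
Proof.
split=> -[c [d]].
  move=> [/beta_mod h1 h2 /beta_mod h3]; exists c, d; split=> //; split=> // i ia.
  by apply/beta_mod; apply: h2 => //; apply/beta_mod.
move=> [h1 [h2 h3]]; exists c, d; split; first exact/beta_mod.
  by move=> i u ia /beta_mod <-; apply/beta_mod; apply: h2.
exact/beta_mod.
Qed.

Lemma drel_is_pow2 (A : set M) : drel A (@is_pow2 M).
Proof.
rewrite /drel; apply: dfn_ext => [e|]; first by apply: iff_sym; apply: is_pow2E.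
by rewrite /modulus; dfn_auto.
Qed.

Lemma is_pow2_0 : is_pow2 (0 : M) 1.
Proof.
have [|c [d h]] := @beta_lemma (fun=> 1) 1; first by dfn_auto.
apply/is_pow2E; exists c, d; split; first exact: h.
by split=> [i /nlt0a//|]; apply: h.
Qed.

Lemma is_pow2_S a b : is_pow2 a b -> is_pow2 (a + 1) (2 * b).
Proof.
move=> /is_pow2E[c [d [h1 [h2 h3]]]].
pose F i := ifA (i <= a) (modA c (modulus d i)) (2 * b).
have hF : dfunT F by apply: dff_if; rewrite /modulus; dfn_auto.
have [c' [d' h]] := beta_lemma (a + 1 + 1) hF.
have E i : i <= a -> modA c' (modulus d' i) = modA c (modulus d i).
  by move=> ia; rewrite h ?/F ?ifT //; apply/ltaSle; apply: lea_trans ia _.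
have E' : modA c' (modulus d' (a + 1)) = 2 * b.
  by rewrite h // /F ifF //; apply/ltNge_a.
apply/is_pow2E; exists c', d'; split; first by rewrite E.
split=> // i /ltaSle ia; rewrite (E i) //; case/lea_lt: ia => [ia|->].
  by rewrite E ?h2 //; apply/leSlt_a.
by rewrite E' h3.
Qed.

Lemma is_pow2_uniq a b b' : is_pow2 a b -> is_pow2 a b' -> b = b'.
Proof.
move=> /is_pow2E[c [d [h1 [h2 <-]]]] /is_pow2E[c' [d' [h1' [h2' <-]]]].
suff H i : i <= a -> modA c (modulus d i) = modA c' (modulus d' i) by apply: H.
move: i; apply: PA_ind => [||i IH ia]; first by rewrite /modulus; dfn_auto.
- by rewrite h1 h1'.
have {}ia : i < a by apply/leSlt_a.
by rewrite h2 // h2' // IH //; apply: ltaW.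
Qed.

Definition pow2 a := mu (is_pow2 a).

Lemma pow2P a : is_pow2 a (pow2 a).
Proof.
have [b hb] : exists b, is_pow2 a b.
  move: a; apply: PA_ind => [||a [b hb]].
  - rewrite /dpred; apply: dfn_ex; apply: dfn_app2 (drel_is_pow2 setT) _ _; dfn_auto.
  - by exists 1; apply: is_pow2_0.
  - by exists (2 * b); apply: is_pow2_S.
apply: muP hb; rewrite /dpred.
by apply: dfn_app2 (drel_is_pow2 setT) _ _; dfn_auto.
Qed.

Lemma pow2_eq a b : is_pow2 a b <-> b = pow2 a.
Proof.
by split=> [h|->]; [apply: is_pow2_uniq h (pow2P a)|apply: pow2P].
Qed.

Lemma dff_pow2 (A : set M) F : dff A F -> dff A (fun e => pow2 (F e)).
Proof.
apply: dff_app1; rewrite /dfun; apply: dff_mu.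
by apply: dfn_app2 (drel_is_pow2 A) _ _; dfn_auto.
Qed.

Ltac dfn_hook ::= first
  [ apply: dfn_lt | apply: dff_mod | apply: dff_div | apply: dff_pair
  | apply: dff_fst | apply: dff_snd | apply: dff_at | apply: dff_pow2
  | apply: dff_if | apply: dff_mu ].

Lemma pow2_0 : pow2 0 = 1.
Proof. by symmetry; apply/pow2_eq; apply: is_pow2_0. Qed.
Lemma pow2_S a : pow2 (a + 1) = 2 * pow2 a.
Proof. by symmetry; apply/pow2_eq; apply: is_pow2_S; apply: pow2P. Qed.
Lemma pow2_D a b : pow2 (a + b) = pow2 a * pow2 b.
Proof.
move: b; apply: PA_ind => [||b IH]; first by dfn_auto.
- by rewrite adda0 pow2_0; ring.
- by rewrite addaA !pow2_S IH; ring.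
Qed.
Lemma pow2_gt a : a < pow2 a.
Proof.
move: a; apply: PA_ind => [||a IH]; first by dfn_auto.
- by rewrite pow2_0.
rewrite pow2_S; move/lt_ex: IH => [z ->]; apply/lt_ex.
by exists (a + z + z); ring.
Qed.
Lemma pow2_gt0 a : 0 < pow2 a.
Proof. exact: lea_lt_trans (le0a a) (pow2_gt a). Qed.

(** * Binary digits *)

Definition bit d i := exists q r p, is_pow2 i p /\ r < p /\ d = (2 * q + 1) * p + r.

Lemma bitE d i : bit d i <-> exists q r, r < pow2 i /\ d = (2 * q + 1) * pow2 i + r.
Proof.
split=> [[q [r [p [/pow2_eq -> h]]]]|[q [r h]]]; first by exists q, r.
by exists q, r, (pow2 i); split=> //; apply: pow2P.
Qed.

Lemma dfn_bit (A : set M) F G : dff A F -> dff A G -> dfn A (fun e => bit (F e) (G e)).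
Proof.
apply: dfn_app2; rewrite /drel.
apply: dfn_ext => [e|]; first by apply: iff_sym; apply: bitE.
dfn_auto.
Qed.

Ltac dfn_hook ::= first
  [ apply: dfn_lt | apply: dfn_bit | apply: dff_mod | apply: dff_div | apply: dff_pair
  | apply: dff_fst | apply: dff_snd | apply: dff_at | apply: dff_pow2
  | apply: dff_if | apply: dff_mu ].

Lemma parity d : exists x b, (b = 0 \/ b = 1) /\ d = 2 * x + b.
Proof.
have [|q [r [hr ->]]] := @div_ex d 2; first by [].
exists q, r; split; last by ring.
by case/ltaSle/lea_lt: hr => [|->]; [rewrite -{1}(add0a 1) => /ltaSle/lea0; left|right].
Qed.

Let parity_inj x b y c : (b = 0 \/ b = 1) -> (c = 0 \/ c = 1) ->
  2 * x + b = 2 * y + c -> x = y /\ b = c.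
Proof.
have lt2 z : (z = 0 \/ z = 1) -> z < 2.
  by case=> ->; [exact: (lt0a 1)|].
by move=> /lt2 hb /lt2 hc; rewrite !(mulaC 2); apply: div_uniq.
Qed.

Lemma bit_0 x b : (b = 0 \/ b = 1) -> bit (2 * x + b) 0 <-> b = 1.
Proof.
move=> hb; rewrite bitE pow2_0; split=> [[q [r [r1 E]]]|->].
  have {}r1 : r = 0 by move: r1; rewrite -{1}(add0a 1) => /ltaSle/lea0.
  have {}E : 2 * x + b = 2 * q + 1 by rewrite E r1; ring.
  by have [|_] := parity_inj hb _ E; first by right.
by exists x, 0; split=> //; ring.
Qed.

Lemma bit_S x b i : (b = 0 \/ b = 1) -> bit (2 * x + b) (i + 1) <-> bit x i.
Proof.
move=> hb; rewrite !bitE pow2_S; split=> -[q [r [hr E]]].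
  have [r' [b' [hb' Er]]] := parity r.
  exists q, r'; split.
    apply/ltNge_a => h; move/ltNge_a: hr; apply; rewrite Er.
    by apply: lea_trans (lea_addr _ _); apply: leaM.
  have E' : 2 * x + b = 2 * ((2 * q + 1) * pow2 i + r') + b' by rewrite E Er; ring.
  by have [] := parity_inj hb hb' E'.
exists q, (2 * r + b); split; last by rewrite E; ring.
move/lt_ex: hr => [z ->]; case: hb => ->; apply/lt_ex.
- by exists (z + z + 1); ring.
- by exists (z + z); ring.
Qed.

Let half_lt x b a : 2 * x + b < pow2 (a + 1) -> x < pow2 a.
Proof.
rewrite pow2_S => h; apply/ltNge_a => h'; move/ltNge_a: h; apply.
by apply: lea_trans (lea_addr _ _); apply: leaM.
Qed.

(** Numbers below [pow2 a] are the codes of the subsets of the interval below [a]. *)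
Lemma bit_inj a d d' : d < pow2 a -> d' < pow2 a ->
  (forall i, i < a -> (bit d i <-> bit d' i)) -> d = d'.
Proof.
move: a d d'; apply: PA_ind => [||a IH d d'].
- by dfn_auto.
- rewrite pow2_0 => d d'; rewrite -{1 2}(add0a 1) => /ltaSle/lea0 -> /ltaSle/lea0 -> //.
have [x [b [hb ->]]] := parity d; have [y [c [hc ->]]] := parity d'.
move=> /half_lt hx /half_lt hy h.
have <- : x = y.
  apply: IH => // i ia; rewrite -(bit_S x i hb) -(bit_S y i hc); apply: h.
  exact/ltaSS.
have := h 0 (lt0a a); rewrite !bit_0 //.
by case: hb => ->; case: hc => -> // [h1 h2]; congr (_ + _);
  [rewrite h2|rewrite h1].
Qed.

Lemma bit_ex (P : M -> Prop) a : dpredT P ->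
  exists d, d < pow2 a /\ forall i, i < a -> (bit d i <-> P i).
Proof.
move=> hP.
suff H s : exists d, d < pow2 a /\ forall i, i < a -> (bit d i <-> P (i + s)).
  by have [d [h1 h2]] := H 0; exists d; split=> // i /h2; rewrite adda0.
move: a s; apply: PA_ind => [||a IH s].
- by dfn_auto.
- by move=> s; exists 0; split=> [|i /nlt0a//]; rewrite pow2_0.
(* The lowest digit is split off, which shifts [P] by one. *)
have [x [hx h]] := IH (s + 1).
pose b : M := ifA (P s) 1 0.
have hb : b = 0 \/ b = 1 by rewrite /b /ifA; case: pselect; [right|left].
exists (2 * x + b); split.
  rewrite pow2_S; move/lt_ex: hx => [z ->]; case: hb => ->; apply/lt_ex.
  - by exists (z + z + 1); ring.
  - by exists (z + z); ring.
move=> i; case: (zero_or_succ i) => [->|[k ->]].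
  move=> _; rewrite bit_0 // add0a /b /ifA; case: pselect => Ps.
    by split.
  by split=> // /esym/(gt0_neq0 (@lt01 M _)).
move=> /ltaSS ka; rewrite bit_S // h //.
by rewrite (_ : k + (s + 1) = k + 1 + s) //; ring.
Qed.

End Coding.

Ltac dfn_hook ::= first
  [ apply: dfn_lt | apply: dfn_bit | apply: dff_mod | apply: dff_div | apply: dff_pair
  | apply: dff_fst | apply: dff_snd | apply: dff_at | apply: dff_pow2
  | apply: dff_if | apply: dff_mu ].

(** * Finite and countable sets *)

Lemma finite_directed (T U : Type) (A : set T) (Q : T -> U -> Prop) (u0 : U) :
  finite_set A -> (forall u v, exists w, forall x, Q x u \/ Q x v -> Q x w) ->
  (forall x, A x -> exists u, Q x u) -> exists u, forall x, A x -> Q x u.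
Proof.
move=> /(finite_seqP (T := {classic T})) [s ->] dir.
elim: s => [_|a s IH H]; first by exists u0.
have [|u hu] := IH.
  by move=> x /= xs; apply: H; rewrite /= in_cons xs orbT.
have [|v hv] := H a; first by rewrite /= in_cons eqxx.
have [w hw] := dir u v; exists w => x /=; rewrite in_cons => /orP[/eqP ->|xs].
- by apply: hw; right.
- by apply: hw; left; apply: hu.
Qed.

Lemma countable_range (T : Type) (x0 : T) (A : set T) : countable A ->
  exists f : nat -> T, A `<=` range f.
Proof.
move=> /countable_injP[g ginj].
pose f n := if pselect (exists x, A x /\ g x = n) is left h
            then projT1 (cid h) else x0.
exists f => x Ax; exists (g x) => //; rewrite /f; case: pselect => [h|[]].
  by case: cid => y /= [Ay E]; apply: ginj => //; rewrite inE.
by exists x.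
Qed.

Lemma countable_setU (T : Type) (A B : set T) :
  countable A -> countable B -> countable (A `|` B).
Proof.
move=> cA cB.
have -> : A `|` B = \bigcup_(b in [set: bool]) (if b then A else B).
  apply/seteqP; split=> [x [Ax|Bx]|x [[] _ h]]; [by exists true|by exists false|
    by left|by right].
by apply: bigcup_countable => [|[]] //; apply: countableP.
Qed.

(** Formulas are encoded as trees, which come with an enumeration. *)
Fixpoint term_tree (t : term) : GenTree.tree nat :=
  match t with
  | Var k => GenTree.Leaf k
  | Zero => GenTree.Node 0 [::]
  | One => GenTree.Node 1 [::]
  | Add a b => GenTree.Node 2 [:: term_tree a; term_tree b]
  | Mul a b => GenTree.Node 3 [:: term_tree a; term_tree b]
  end.
Fixpoint tree_term (t : GenTree.tree nat) : term :=
  match t with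
  | GenTree.Leaf k => Var k
  | GenTree.Node 1 _ => One
  | GenTree.Node 2 [:: a; b] => Add (tree_term a) (tree_term b)
  | GenTree.Node 3 [:: a; b] => Mul (tree_term a) (tree_term b)
  | _ => Zero
  end.
Lemma term_treeK : cancel term_tree tree_term.
Proof. by elim=> //= [a -> b ->|a -> b ->]. Qed.

Fixpoint formula_tree (f : formula) : GenTree.tree nat :=
  match f with
  | Eq s t => GenTree.Node 0 [:: term_tree s; term_tree t]
  | Le s t => GenTree.Node 1 [:: term_tree s; term_tree t]
  | Not g => GenTree.Node 2 [:: formula_tree g]
  | And g h => GenTree.Node 3 [:: formula_tree g; formula_tree h]
  | Or g h => GenTree.Node 4 [:: formula_tree g; formula_tree h]
  | Imp g h => GenTree.Node 5 [:: formula_tree g; formula_tree h]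
  | All g => GenTree.Node 6 [:: formula_tree g]
  | Ex g => GenTree.Node 7 [:: formula_tree g]
  end.
Fixpoint tree_formula (t : GenTree.tree nat) : formula :=
  match t with
  | GenTree.Node 0 [:: a; b] => Eq (tree_term a) (tree_term b)
  | GenTree.Node 1 [:: a; b] => Le (tree_term a) (tree_term b)
  | GenTree.Node 2 [:: a] => Not (tree_formula a)
  | GenTree.Node 3 [:: a; b] => And (tree_formula a) (tree_formula b)
  | GenTree.Node 4 [:: a; b] => Or (tree_formula a) (tree_formula b)
  | GenTree.Node 5 [:: a; b] => Imp (tree_formula a) (tree_formula b)
  | GenTree.Node 6 [:: a] => All (tree_formula a)
  | GenTree.Node 7 [:: a] => Ex (tree_formula a)
  | _ => Eq Zero Zero
  end.
Lemma formula_treeK : cancel formula_tree tree_formula.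
Proof.
by elim=> //= [s t|s t|g ->|g -> h ->|g -> h ->|g -> h ->|g ->|g ->] //;
  rewrite !term_treeK.
Qed.

Definition enum_formula (C : countType) (c0 : C) (n : nat) : formula * C :=
  if @unpickle (GenTree.tree nat * C)%type n is Some (t, c) then (tree_formula t, c)
  else (Eq Zero Zero, c0).
Lemma enum_formulaP (C : countType) (c0 : C) f c :
  exists n, enum_formula c0 n = (f, c).
Proof.
by exists (pickle (formula_tree f, c)); rewrite /enum_formula pickleK formula_treeK.
Qed.

(** * Definable sets, cuts and overspill *)

Section Cuts.
Context (M : arith_structure) {HM : PA_model M}.
Implicit Types a b x y z : M.
Add Ring PA_ring : (PA_srt (M := M)).
Notation dpredT := (@dpred M setT).
Notation dfunT := (@dfun M setT).

Lemma dpred_sat f (e : nat -> M) : dpredT (fun x => sat (scons x e) f).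
Proof.
rewrite /dpred.
apply: (@dfn_ext M _ (fun e' => sat (fun k => (if k is k'.+1 then fun=> e k'
   else fun e' : nat -> M => e' 0%N) e') f)).
  by move=> e'; rewrite (_ : (fun k => _) = scons (e' 0%N) e) //;
    apply/funext => -[|k].
by apply: dfn_sat => -[|k]; dfn_auto.
Qed.

Lemma Def_dpred D : Def M D -> dpredT D.
Proof. by move=> [[f e] ->]; apply: (dpred_sat f e). Qed.

Lemma dpred_Def (P : M -> Prop) : dpredT P -> Def M [set x | P x].
Proof.
move=> hP; have [f [e [_ h]]] := dfn_formula 1 (A := setT) I hP.
exists (f, e); rewrite /sat_over /=; apply/funext => x; apply/propext.
exact: (h [:: x]).
Qed.

Context (I : set M) (I_cut : is_cut I).

Lemma cut_le a b : I b -> a <= b -> I a.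
Proof.
case: I_cut => _ _ h Ib ab; apply: h Ib _; exact: lea_trans ab (leaS b).
Qed.
Lemma cut_S a : I a -> I (a + 1).
Proof. by case: I_cut => _ _ h Ia; apply: h Ia _. Qed.
Lemma cut_0 : I 0.
Proof. by case: I_cut => -[b Ib] _ _; apply: cut_le Ib _. Qed.
Lemma cut_lt a b : I a -> ~ I b -> a < b.
Proof. by move=> Ia nIb; apply/ltNge_a => /(cut_le Ia). Qed.
Lemma cut_out : exists b, ~ I b.
Proof.
case: I_cut => _ h _; apply: contrapT => n; apply: h; apply/seteqP; split=> // x _.
by apply: contrapT => nIx; apply: n; exists x.
Qed.
Lemma cut_pred a : ~ I a -> exists2 b, ~ I b & a = b + 1.
Proof.
case: (zero_or_succ a) => [->|[b ->]]; first by case; apply: cut_0.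
by move=> h; exists b => // Ib; apply: h; apply: cut_S.
Qed.

(** Otherwise the formula saying that [P] holds up to [x] would define [I], against
    induction. *)
Lemma overspill (P : M -> Prop) : dpredT P -> (forall x, I x -> P x) ->
  exists2 x, ~ I x & P x.
Proof.
move=> hP IP; apply: contrapT => n.
have E x : (forall y, y <= x -> P y) <-> I x.
  split=> [h|Ix y yx]; last by apply: IP; apply: cut_le yx.
  by apply: contrapT => nIx; apply: n; exists x => //; apply: h.
have [b] := cut_out; apply; move: b; apply: PA_ind.
- rewrite /dpred; apply: (@dfn_ext M _ (fun e => forall y, y <= e 0%N -> P y)).
    by move=> e; apply: E.
  by dfn_auto.
- exact: cut_0.
- exact: cut_S.
Qed.

(** A cut has no finite downward cofinal set, as its complement has no least element;
    so a sequence coinitial in the complement gives countable downward cofinality. *)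
Lemma dcf_of_seq (b : nat -> M) : (forall n, ~ I (b n)) ->
  (forall x, ~ I x -> exists n, b n <= x) -> dcf_is I [set: nat].
Proof.
move=> bI bcof.
have inf X : downward_cofinal I X -> ([set: nat] #<= X)%card.
  move=> [XI EI]; apply/infiniteP => Xfin.
  have [b0 b0I] := cut_out.
  have [||[z zI] /= hz] := @finite_directed M {z | ~ I z} X
    (fun x v => proj1_sig v <= x) (exist _ b0 b0I) Xfin.
  - move=> [u uI] [v vI] /=; case: (lta_total u v) => uv.
      exists (exist _ u uI) => x /= [//|vx]; apply: lea_trans vx; exact: ltaW.
    exists (exist _ v vI) => x /= [ux|//]; exact: lea_trans ux.
  - by move=> x /XI Ix; exists (exist _ x Ix).
  have [w wI Ew] := cut_pred zI; apply: wI; rewrite EI /= => x /hz.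
  by rewrite Ew => /leSlt_a.
have dB : downward_cofinal I (range b).
  split=> [x [n _ <-]|]; first exact: bI.
  apply/seteqP; split=> [x Ix y [n _ <-]|x /= h]; first exact: cut_lt (bI n).
  apply: contrapT => nIx; have [n hn] := bcof x nIx.
  by have /ltNge_a := h (b n) (ex_intro2 _ _ n Logic.I erefl); apply.
split=> //; exists (range b) => //.
rewrite card_eq_le (inf _ dB) andbT; exact: card_image_le.
Qed.

Lemma seq_of_dcf : dcf_is I [set: nat] -> exists b : nat -> M,
  (forall n, ~ I (b n)) /\ (forall x, ~ I x -> exists n, b n <= x).
Proof.
move=> [[X [XI EI] cX] _].
have [b0 b0I] := cut_out.
have /(countable_range b0)[f hf] : countable X.
  by move: cX; rewrite card_eq_le => /andP[].
pose b n := if pselect (X (f n)) is left _ then f n else b0.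
exists b; split=> [n|x nIx].
  by rewrite /b; case: pselect => // /XI.
have [y Xy yx] : exists2 y, X y & y <= x.
  apply: contrapT => n; apply: nIx; rewrite EI /= => y Xy; apply/ltNge_a => yx.
  by apply: n; exists y.
have [n _ En] := hf y Xy; exists n; rewrite /b En; by case: pselect.
Qed.

Section ExpClosed.
Context (I_exp : exp_closed I).

Lemma cut_pow2 a : I a -> I (pow2 a).
Proof. by move=> /I_exp[b /pow2_eq ->]. Qed.
(** If [a] is at most [b], then [a b] is at most [2^b 2^b = 2^(b + b)], and [b + b] is
    at most [2^(2^b + 1)]. *)
Lemma cut_mul a b : I a -> I b -> I (a * b).
Proof.
wlog ab : a b / a <= b.
  move=> H Ia Ib; case: (lta_total a b) => [/ltaW h|h]; first exact: H.
  by rewrite mulaC; apply: H.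
move=> _ Ib; have I1 := cut_pow2 (cut_S (cut_pow2 Ib)).
have H x : x <= pow2 x by apply: ltaW; apply: pow2_gt.
have : I (pow2 b * pow2 b).
  rewrite -pow2_D; apply: cut_pow2; apply: cut_le I1 _; rewrite pow2_S.
  have -> : (1 + 1) * pow2 (pow2 b) = pow2 (pow2 b) + pow2 (pow2 b) by ring.
  by apply: leaD; apply: lea_trans (H _) (H _).
by move/cut_le; apply; apply: leaM => //; apply: lea_trans ab _.
Qed.
Lemma cut_add a b : I a -> I b -> I (a + b).
Proof.
move=> Ia Ib.
have /cut_le : I ((a + 1) * (b + 1)) by apply: cut_mul; apply: cut_S.
by apply; apply/le_ex; exists (a * b + 1); ring.
Qed.
Lemma cut_pair a b : I a -> I b -> I (pairA a b).
Proof.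
by move=> Ia Ib; rewrite /pairA; do ![apply: cut_add|apply: cut_mul].
Qed.
End ExpClosed.

End Cuts.

(** * Elementary embeddings *)

(** Explicit formulas for powers of two and binary digits.  Definability in each model
    separately would not do here: transfer along an elementary embedding
    takes the same formula in both models. *)
Definition fLt s t := And (Le s t) (Not (Eq s t)).
Definition tlift := tsubst (fun i => Var i.+1).
Definition fModulus i d := Add One (Mul (Add i One) d).
Definition fBeta c d i u :=
  And (fLt u (fModulus i d))
      (Ex (Eq (tlift c) (Add (Mul (Var 0) (tlift (fModulus i d))) (tlift u)))).
Definition fPow2 :=
  Ex (Ex (And (fBeta (Var 1) (Var 0) Zero One)
    (And (All (All (Imp (fLt (Var 1) (Var 4))
                   (Imp (fBeta (Var 3) (Var 2) (Var 1) (Var 0))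
                        (fBeta (Var 3) (Var 2) (Add (Var 1) One)
                               (Mul (Add One One) (Var 0)))))))
         (fBeta (Var 1) (Var 0) (Var 2) (Var 3))))).

Lemma sat_fPow2 (M : arith_structure) (e : nat -> M) :
  sat e fPow2 <-> is_pow2 (e 0%N) (e 1%N).
Proof.
rewrite /is_pow2 /beta /=; split=> -[c [d h]]; exists c, d.
  by case: h => h1 [h2 h3]; split.
by case: h.
Qed.

Definition fBit :=
  Ex (Ex (Ex (And (fsubst (scons (Var 4) (fun=> Var 0)) fPow2)
    (And (fLt (Var 1) (Var 0))
         (Eq (Var 3) (Add (Mul (Add (Mul (Add One One) (Var 2)) One) (Var 0))
                          (Var 1))))))).

Lemma sat_fBit (M : arith_structure) (e : nat -> M) :
  sat e fBit <-> bit (e 0%N) (e 1%N).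
Proof.
have E q r p : sat (scons p (scons r (scons q e)))
    (fsubst (scons (Var 4) (fun=> Var 0)) fPow2) <-> is_pow2 (e 1%N) p.
  by apply: iff_trans (sat_fsubst _ _ _) _; apply: sat_fPow2.
by rewrite /bit; split=> -[q [r [p [h1 h2]]]]; exists q, r, p; split=> //;
  apply/(E q r p).
Qed.

Section Elementary.
Context (M N : arith_structure) (j : M -> N) (j_el : elementary j).

Lemma comp_scons x (e : nat -> M) : j \o scons x e = scons (j x) (j \o e).
Proof. by apply/funext => -[|k]. Qed.

Lemma elementary1 f e x : sat (scons x e) f <-> sat (scons (j x) (j \o e)) f.
Proof. by rewrite -comp_scons. Qed.

Let elem3 f (x y z : M) :
  sat (scons x (scons y (fun=> z))) f <->
  sat (scons (j x) (scons (j y) (fun=> j z))) f.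
Proof. by rewrite (j_el f) !comp_scons. Qed.

Lemma elem_inj x y : j x = j y -> x = y.
Proof. exact: (elem3 (Eq (Var 0) (Var 1)) x y y).2. Qed.
Lemma elem_1 : j 1 = 1.
Proof. exact: (j_el (Eq (Var 0) One) (fun=> 1)).1. Qed.
Lemma elem_add x y : j (x + y) = j x + j y.
Proof. by symmetry; apply: (elem3 (Eq (Add (Var 0) (Var 1)) (Var 2)) x y (x + y)).1. Qed.
Lemma elem_mul x y : j (x * y) = j x * j y.
Proof. by symmetry; apply: (elem3 (Eq (Mul (Var 0) (Var 1)) (Var 2)) x y (x * y)).1. Qed.
Lemma elem_le x y : x <= y <-> j x <= j y.
Proof. exact: (elem3 (Le (Var 0) (Var 1)) x y y). Qed.
Lemma elem_lt x y : x < y <-> j x < j y.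
Proof. exact: (elem3 (fLt (Var 0) (Var 1)) x y y). Qed.
Lemma elem_pair x y : j (pairA x y) = pairA (j x) (j y).
Proof. by rewrite /pairA !(elem_add, elem_mul). Qed.

Fixpoint close n f := if n is n'.+1 then close n' (All f) else f.

Lemma sat_close (S : arith_structure) n f (e : nat -> S) :
  sat e (close n f) <-> forall xs, size xs = n -> sat (foldr (@scons S) e xs) f.
Proof.
elim: n f e => [|n IH] f e /=.
  by split=> [h [|//] _ //|/(_ [::] erefl)].
rewrite IH; split=> [h [//|x xs] [sz]|h xs sz x] /=; first exact: h.
by apply: (h (x :: xs)); rewrite /= sz.
Qed.

(** Elementarity concerns environments in [M], while the axioms have to hold in all
    environments in [N]; so their universal closures are transferred. *)
Lemma elementary_PA : PA_model M -> PA_model N.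
Proof.
move=> HM f fPA e.
have : sat (fun=> j 0) (close (fbound f) f).
  by apply/(j_el _ (fun=> 0)); apply/sat_close => xs _; apply: HM.
move/sat_close => /(_ (mkseq e (fbound f))); rewrite size_mkseq => /(_ erefl).
apply: (sat_fbound _).1 => k kb.
elim: (fbound f) e k kb => [//|n IH] e [|k] //= kn.
by rewrite /mkseq (iotaDl 1 0) -map_comp; apply: (IH (e \o S)).
Qed.

Context {HM : PA_model M} {HN : PA_model N}.

Lemma elem_pow2 a : j (pow2 a) = pow2 (j a).
Proof.
apply/pow2_eq; apply/(sat_fPow2 (scons (j a) (fun=> j (pow2 a)))).
rewrite -(comp_scons a (fun=> pow2 a)); apply/j_el/sat_fPow2; exact: pow2P.
Qed.

Lemma elem_bit d i : bit d i <-> bit (j d) (j i).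
Proof.
rewrite -(sat_fBit (scons d (fun=> i))) -(sat_fBit (scons (j d) (fun=> j i))).
by rewrite (j_el fBit) comp_scons.
Qed.

Lemma elem_uniq f (e : nat -> M) x : (forall z, sat (scons z e) f -> z = x) ->
  forall z, sat (scons z (j \o e)) f -> z = j x.
Proof.
move=> h z hz; pose s := scons (Var 0) (fun k => Var k.+2).
have Es (S : arith_structure) (a b : S) e' :
    (fun k => eval (scons a (scons b e')) (s k)) = scons a e'.
  by apply/funext => -[].
have : sat (scons x e) (All (Imp (fsubst s f) (Eq (Var 0) (Var 1)))).
  by move=> w /sat_fsubst; rewrite Es => /h.
move/(elementary1 _) => /(_ z) H; apply: H; apply/sat_fsubst.
by rewrite Es.
Qed.

End Elementary.

(** * Elementary submodels *)

Section Submodel.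
Context (M : arith_structure) {HM : PA_model M}.

Definition closed_under_witnesses (K : set M) :=
  forall f (e : nat -> M), (forall k, K (e k)) ->
    (exists x, sat (scons x e) f) -> exists2 x, K x & sat (scons x e) f.

Lemma tarski_vaught (K : set M) a : K a -> closed_under_witnesses K ->
  exists (S : arith_structure) (k : S -> M), elementary k /\ range k = K.
Proof.
move=> Ka clK.
have K1 f e x : (forall k, K (e k)) -> (forall y, sat (scons y e) f <-> y = x) -> K x.
  move=> Ke h; have [|y Ky] := clK f e Ke; first by exists x; apply/h.
  by move/h => <-.
have K0 : K 0 by apply: (K1 (Eq (Var 0) Zero) (fun=> a)).
have K_1 : K 1 by apply: (K1 (Eq (Var 0) One) (fun=> a)).
have Kadd x y : K x -> K y -> K (x + y).
  move=> Kx Ky; apply: (K1 (Eq (Var 0) (Add (Var 1) (Var 2))) (scons x (fun=> y))).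
    by case.
  by [].
have Kmul x y : K x -> K y -> K (x * y).
  move=> Kx Ky; apply: (K1 (Eq (Var 0) (Mul (Var 1) (Var 2))) (scons x (fun=> y))).
    by case.
  by [].
pose T := {x : M | K x}.
pose S := @ArithStructure T (exist _ _ K0) (exist _ _ K_1)
  (fun x y => exist _ _ (Kadd _ _ (proj2_sig x) (proj2_sig y)))
  (fun x y => exist _ _ (Kmul _ _ (proj2_sig x) (proj2_sig y)))
  (fun x y => proj1_sig x <= proj1_sig y).
pose k : S -> M := @proj1_sig _ _.
have kE (e : nat -> S) t : k (eval e t) = eval (k \o e) t.
  by elim: t => //= [t1 <- t2 <-|t1 <- t2 <-].
have k_inj x y : k x = k y -> x = y.
  case: x y => [x hx] [y hy] /= E; move: hx hy; rewrite E => hx hy.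
  by congr exist; apply: Prop_irrelevance.
exists S, k; split; last first.
  apply/seteqP; split=> [_ [x _ <-]|x Kx]; first exact: proj2_sig x.
  by exists (exist _ x Kx).
have comp x (e : nat -> S) : k \o scons x e = scons (k x) (k \o e).
  by apply/funext => -[|i].
elim=> /=.
- by move=> t1 t2 e; rewrite -!kE; split=> [->//|/k_inj].
- by move=> t1 t2 e; rewrite -!kE.
- by move=> f IH e; rewrite IH.
- by move=> f IHf g IHg e; rewrite IHf IHg.
- by move=> f IHf g IHg e; rewrite IHf IHg.
- by move=> f IHf g IHg e; rewrite IHf IHg.
- move=> f IH e; split=> [h x|h x]; last by apply/IH; rewrite comp.
  apply: contrapT => nx.
  have [||y Ky ny] := clK (Not f) (k \o e).
  + by move=> i; apply: proj2_sig (e i).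
  + by exists x.
  by apply: ny; move: (h (exist _ y Ky)); rewrite IH comp.
- move=> f IH e; split=> [[x]|[x hx]]; first by rewrite IH comp => h; exists (k x).
  have [||y Ky hy] := clK f (k \o e).
  + by move=> i; apply: proj2_sig (e i).
  + by exists x.
  by exists (exist _ y Ky); rewrite IH comp.
Qed.

Lemma generates_full (X K : set M) a : generates X -> K a ->
  closed_under_witnesses K -> X `<=` K -> forall x, K x.
Proof.
move=> gen Ka clK XK x; apply: contrapT => nKx; apply: gen.
have [S [k [k_el k_range]]] := tarski_vaught Ka clK.
exists S, k; rewrite /proper_elementary k_range; split=> //; split=> // E.
by apply: nKx; rewrite E.
Qed.

(** In a model of arithmetic, a set that contains every element definable from it is
    already closed under witnesses: the least witness is definable. *)
Lemma closed_least (K : set M) :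
  (forall f e x, (forall k, K (e k)) -> least (fun x => sat (scons x e) f) x -> K x) ->
  closed_under_witnesses K.
Proof.
move=> h f e Ke [x hx].
have [h1 h2] := mu_least (dpred_sat f e) hx.
by exists (mu (fun x => sat (scons x e) f)) => //; exact: (h f e _ Ke (conj h1 h2)).
Qed.

Definition fLeast f :=
  And f (All (Imp (fsubst (scons (Var 0) (fun k => Var k.+2)) f)
                  (Le (Var 1) (Var 0)))).

Lemma sat_fLeast f (e : nat -> M) x :
  sat (scons x e) (fLeast f) <-> least (fun x => sat (scons x e) f) x.
Proof.
rewrite /least /=; split=> -[h1 h2]; split=> // y.
  move=> hy; apply: h2; apply/sat_fsubst.
  by rewrite (_ : (fun k => _) = scons y e) //; apply/funext => -[].
move/sat_fsubst => hy; apply: h2; move: hy.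
by rewrite (_ : (fun k => _) = scons y e) //; apply/funext => -[].
Qed.

End Submodel.

(** The formula that defines [x] has a solution in [S] by elementarity, and its
    image can only be [x]. *)
Lemma range_definable (S N : arith_structure) (k : S -> N) (f : formula)
    (e : nat -> N) (x : N) : elementary k -> (forall i, range k (e i)) ->
  (forall y, sat (scons y e) f <-> y = x) -> range k x.
Proof.
move=> k_el ke h.
have [u hu] : {u : nat -> S & forall i, k (u i) = e i}.
  by apply: (choice (P := fun i y => k y = e i)) => i; have [y _ E] := ke i; exists y.
have Eu : k \o u = e by apply/funext.
have : sat u (Ex f) by apply/k_el; rewrite Eu; exists x; apply/h.
by move=> [y /(elementary1 k_el)]; rewrite Eu => /h <-; exists y.
Qed.

(** The preimage under [j] of an elementary submodel of [N] is closed under witnesses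
    in [M], hence contains everything as soon as it contains [X]. *)
Lemma generates_trans (M N : arith_structure) (j : M -> N) (X : set M) (Y : set N) :
  PA_model M -> PA_model N -> X !=set0 ->
  elementary j -> generates X -> generates (Y `|` range j) ->
  generates (Y `|` j @` X).
Proof.
move=> HM HN [x0 Xx0] j_el genM genN [K [k [[k_el k_proper] sub]]].
apply: genN; exists K, k; split=> // y [Yy|[x _ <-]]; first by apply: sub; left.
apply: (@generates_full M X [set x | range k (j x)] x0) => //.
- by apply: sub; right; exists x0.
- apply: closed_least => f e {}x Ke hx /=.
  apply: (@range_definable _ _ k (fLeast f) (j \o e)) => // z.
  have hjx : sat (scons (j x) (j \o e)) (fLeast f).
    by apply/(elementary1 j_el); apply/sat_fLeast.
  split=> [|-> //] /sat_fLeast hz; apply: least_uniq hz _; exact/sat_fLeast.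
- by move=> z Xz; apply: sub; right; exists z.
Qed.

(** * Models generated over a cut *)

Section Generated.
Context (M : arith_structure) {HM : PA_model M}.
Context (I : set M) (I0 : I 0) (I_pair : forall x y, I x -> I y -> I (pairA x y)).
Context (A : set M) (A0 : A 0).

(** Since [I] is closed under pairs, one argument from [I] can carry the information
    of finitely many. *)
Lemma common_argument (e : nat -> M) n :
  (forall k, exists t y, [/\ dfun A t, I y & e k = t y]) ->
  exists s : nat -> M -> M, exists y, [/\ I y, forall k, dfun A (s k)
    & forall k, (k < n)%N -> e k = s k y].
Proof.
move=> h; elim: n => [|n [s [y [Iy sA hs]]]].
  by exists (fun=> id), 0; split=> // k; rewrite /dfun; dfn_auto.
have [t [z [tA Iz Ez]]] := h n.
exists (fun k x => if (k < n)%N then s k (fstA x) else t (sndA x)), (pairA y z).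
split; first exact: I_pair.
- by move=> k; have H := sA k; case: (k < n)%N; dfn_auto.
- move=> k; rewrite ltnS leq_eqVlt => /orP[/eqP ->|kn]; first by rewrite ltnn sndA_pair.
  by rewrite kn fstA_pair hs.
Qed.

(** The values on [I] of the functions that are definable over [A] are closed under
    witnesses, by composition with the least-witness functions. *)
Lemma generated_values (X : set M) : X `<=` A -> generates (X `|` I) ->
  forall x, exists t y, [/\ dfun A t, I y & x = t y].
Proof.
move=> XA gen.
have AK x : A x -> exists t y, [/\ dfun A t, I y & x = t y].
  by move=> Ax; exists (fun=> x), 0; split=> //; rewrite /dfun; dfn_auto.
apply: (generates_full gen (AK 0 A0)); last first.
  move=> x [/XA/AK//|Ix]; exists id, x; split=> //; rewrite /dfun; dfn_auto.
apply: closed_least => f e x Ke [hx hmin].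
have [s [y [Iy sA hs]]] := common_argument (fbound f) Ke.
have E z : sat (scons z e) f <-> sat (scons z (s^~ y)) f.
  by apply: sat_fbound => -[|k] //= kb; rewrite hs //; apply: ltnW.
exists (fun y => mu (fun z => sat (scons z (s^~ y)) f)), y; split=> //.
- rewrite /dfun; apply: dff_mu.
  apply: (@dfn_ext M _ (fun e' => sat (fun k => (if k is k'.+1 then
      fun e' : nat -> M => s k' (e' 1%N) else fun e' : nat -> M => e' 0%N) e') f)).
    move=> e'; rewrite (_ : (fun k => _) = scons (e' 0%N) (s^~ (e' 1%N))) //.
    by apply/funext => -[|k].
  by apply: dfn_sat => -[|k]; [|have H := sA k]; dfn_auto.
- symmetry; apply: mu_leastE; split=> [|z /E]; [exact/E|exact: hmin].
Qed.

(** A function definable over [A] is determined by a formula and finitely many elements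
    of [A]: the parameters beyond the variables of the formula do not matter. *)
Lemma enum_dfun : countable A -> exists T : nat -> M -> M,
  (forall n, dfun setT (T n)) /\ (forall t, dfun A t -> exists n, T n = t).
Proof.
move=> /(countable_range 0)[a Aa].
pose T n := let c := enum_formula ([::] : seq nat) n in
  fun y => mu (fun z => sat (scons z (scons y (fun k => a (nth 0%N c.2 k)))) c.1).
exists T; split=> [n|t tA].
  rewrite /T; move: (enum_formula _ n) => [f ns] /=; rewrite /dfun; apply: dff_mu.
  pose G k : (nat -> M) -> M := match k with
    | 0%N => fun e => e 0%N | 1%N => fun e => e 1%N
    | k'.+2 => fun=> a (nth 0%N ns k') end.
  apply: (@dfn_ext M _ (fun e => sat (G^~ e) f)) => [e|].
    by rewrite (_ : G^~ e = scons (e 0%N) (scons (e 1%N) (fun k => a (nth 0%N ns k)))) //;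
      apply/funext => -[|[|k]].
  by apply: dfn_sat => -[|[|k]] /=; dfn_auto.
have [f [e [Ae hf]]] := dfn_formula 2 A0 tA.
have [c hc] : {c : nat -> nat & forall k, a (c k) = e k}.
  apply: (choice (P := fun k n => a n = e k)) => k.
  by have [n _ E] := Aa _ (Ae k); exists n.
have [n hn] := enum_formulaP ([::] : seq nat) f (mkseq c (fbound f)).
exists n; apply/funext => y; rewrite /T hn; apply: mu_eq => z.
rewrite (hf [:: z; y] erefl) /=; apply: sat_fbound => -[|[|k]] //= kb.
by rewrite nth_mkseq //; apply: ltnW; apply: ltnW.
Qed.

End Generated.

(** * From the extension to the cut *)

Section ExtensionToCut.
Context (M N : arith_structure) {HM : PA_model M} {HN : PA_model N}.
Context (j : M -> N) (j_el : elementary j).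
Context (I : set M) (I_cut : is_cut I).
Context (GI : GCIS j = I) (CI : same_Cod j I).

Lemma below_cut y b : I b -> y <= j b -> exists2 x, I x & j x = y.
Proof.
move=> Ib yb; have : GCIS j b by rewrite GI.
rewrite /GCIS /= => E; have : [set y | y <= j b] y by [].
by rewrite -E => -[x xb <-]; exists x => //; apply: cut_le Ib xb.
Qed.

Lemma new_below b : ~ I b -> exists2 y, y <= j b & ~ range j y.
Proof.
move=> nIb; apply: contrapT => n; apply: nIb; rewrite -GI /GCIS /=.
apply/seteqP; split=> [_ [x xb <-]|y /= yb]; first exact/(elem_le j_el).
apply: contrapT => ny; apply: n; exists y => // -[x _ E]; apply: ny.
by exists x => //=; apply/(elem_le j_el); rewrite E.
Qed.

Lemma image_cut : is_cut (j @` I).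
Proof.
have I0 : I 0 by exact: cut_0.
split; first by exists (j 0); exists 0.
  move=> E; have [b nIb] := cut_out I_cut.
  have : (j @` I) (j b) by rewrite E.
  by move=> [x Ix /(elem_inj j_el) xb]; apply: nIb; rewrite -xb.
move=> a _ [b Ib <-]; rewrite -(elem_1 j_el) -(elem_add j_el).
by move/(below_cut (cut_S I_cut Ib)) => [x Ix <-]; exists x.
Qed.

Lemma cod_pull (P : N -> Prop) : dpred setT P ->
  exists2 D : M -> Prop, dpred setT D & forall y, I y -> (P (j y) <-> D y).
Proof.
move=> /dpred_Def hP.
have : Cod (j @` I) ((j @` I) `&` [set x | P x]) by exists [set x | P x].
rewrite CI => -[_ [D hD <-] E]; exists D; first exact: Def_dpred.
move=> y Iy; split=> [Py|Dy].
  have : ((j @` I) `&` [set x | P x]) (j y) by split=> //; exists y.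
  by rewrite -E => -[x [_ Dx] /(elem_inj j_el) <-].
have : (j @` (I `&` D)) (j y) by exists y.
by rewrite E => -[].
Qed.

(** If [2 ^ a] were outside [I] for some [a] in [I], there would be a new number
    below it; its binary digits form a subset of [I] that is already coded in [M]. *)
Lemma extension_exp_closed : exp_closed I.
Proof.
move=> a Ia; exists (pow2 a); first exact: pow2P.
apply: contrapT => /new_below[y yb y_new].
have {}yb : y < pow2 (j a).
  case/lea_lt: yb => [|E]; first by rewrite (elem_pow2 j_el).
  by case: y_new; exists (pow2 a).
have [|D hD h] := @cod_pull (fun i => bit y i); first by dfn_auto.
have [d [da hd]] := bit_ex a hD.
apply: y_new; exists d => //; apply: (@bit_inj N _ (j a)) => //.
  by rewrite -(elem_pow2 j_el); apply/(elem_lt j_el).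
move=> i ia; have [k Ik Ek] := below_cut Ia (ltaW ia).
rewrite -Ek -(elem_bit j_el) hd ?h //; apply/(elem_lt j_el).
by rewrite Ek.
Qed.

Lemma not_filling : ~ filling j -> forall a, (forall x, I x -> j x < a) ->
  exists2 y, ~ I y & j y <= a.
Proof.
move=> nf a ha; apply: contrapT => n; apply: nf; exists a => x y.
rewrite GI => Ix nIy; split; first exact: ha.
by apply/ltNge_a => h; apply: n; exists y.
Qed.

(** As [a] separates [I] from its complement in [M], the condition that [t y] belongs
    to [I] is expressed in [N] by [t y < a], and therefore coded in [M].  Hence [M]
    can speak of the values of [t] outside [I], and overspill bounds them from
    below. *)
Lemma values_outside a : (forall x y, I x -> ~ I y -> j x < a /\ a < j y) ->
  forall t, dfun setT t -> exists2 b, ~ I b & forall y, I y -> ~ I (t y) -> b <= t y.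
Proof.
move=> ha t ht.
have [f [e [_ h]]] := dfn_formula 2 (A := setT) Logic.I ht.
have {}h y z : z = t y <-> sat (scons z (scons y e)) f by exact: (h [:: z; y]).
have [|D hD hDI] := @cod_pull (fun y => exists z, z < a /\
    sat (scons z (scons y (j \o e))) f).
  rewrite /dpred; apply: dfn_ex; apply: dfn_and; first by dfn_auto.
  apply: (@dfn_ext N _ (fun e' => sat (fun k => (match k with
     | 0%N => fun e' : nat -> N => e' 0%N | 1%N => fun e' : nat -> N => e' 1%N
     | k'.+2 => fun=> j (e k') end) e') f)).
    move=> e'; rewrite (_ : (fun k => _) = scons (e' 0%N) (scons (e' 1%N) (j \o e))) //.
    by apply/funext => -[|[|k]].
  by apply: dfn_sat => -[|[|k]]; dfn_auto.
have {}hDI y : I y -> D y <-> I (t y).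
  move=> Iy; rewrite -hDI //; split=> [[z [za]]|It].
    rewrite -(comp_scons j) => /(elem_uniq j_el (fun w => (h y w).2)) Ez.
    apply: contrapT => /(ha y _ Iy)[_]; rewrite -Ez => az.
    exact: lta_irr (lta_trans za az).
  exists (j (t y)); split; first by have [b /(ha _ _ It)[]] := cut_out I_cut.
  by rewrite -!(comp_scons j); apply/j_el/h.
have [||b nIb hb] := @overspill M _ I I_cut (fun v => forall y, y < v -> ~ D y -> v < t y).
- by dfn_auto.
- move=> v Iv y yv; have Iy : I y by apply: cut_le Iv (ltaW yv).
  by rewrite hDI // => nI; apply: cut_lt nI.
exists b => // y Iy nI; apply/ltaW/hb; first exact: cut_lt nIb.
by rewrite hDI.
Qed.

(** In the non-filling case the complement of [I] in [M] is coinitial in that in [N].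
    The digits of the values of [g] at places in [I] are coded in [M] by a set [D];
    the coding remains right up to some place outside [I], so that small enough
    values of [g] are determined by [D] and lie in [M]. *)
Lemma small_values : ~ filling j -> forall g : N -> N, dfun setT g ->
  exists2 b, ~ I b & forall y, I y -> g (j y) < j b -> range j (g (j y)).
Proof.
move=> nf g hg.
have I_exp := extension_exp_closed.
have [|D hD hDI] := @cod_pull (fun p => bit (g (fstA p)) (sndA p)); first by dfn_auto.
have [f [e [_ hf]]] := dfn_formula 1 (A := setT) Logic.I hD.
have {}hf p : D p <-> sat (scons p e) f by exact: (hf [:: p]).
pose DN p := sat (scons p (j \o e)) f.
have hDN : dpred setT DN by exact: dpred_sat.
have [||v nIv hv] := @overspill N _ _ image_cut (fun v => forall y k, y < v -> k < v ->
   (bit (g y) k <-> DN (pairA y k))).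
- by dfn_auto.
- move=> _ [v Iv <-] y k yv kv.
  have [y' Iy Ey] := below_cut Iv (ltaW yv); have [k' Ik Ek] := below_cut Iv (ltaW kv).
  rewrite -Ey -Ek -(elem_pair j_el) /DN -(elementary1 j_el) -hf -hDI.
    by rewrite (elem_pair j_el) fstA_pair sndA_pair.
  exact: cut_pair.
have [|b nIb bv] := not_filling nf (a := v).
  by move=> x Ix; apply: (cut_lt image_cut) => //; exists x.
exists b => // y Iy gb.
have [|d [db hd]] := @bit_ex M _ (fun k => D (pairA y k)) b; first by dfn_auto.
exists d => //; apply: (@bit_inj N _ (j b)).
- by rewrite -(elem_pow2 j_el); apply/(elem_lt j_el).
- by apply: lta_trans gb _; apply: pow2_gt.
move=> k kb; rewrite hv; first last.
- exact: lta_le_trans kb bv.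
- by apply: (cut_lt image_cut) => //; exists y.
(* The defining property of [d] is transferred to [N]: the variables are the place
   [k], then [d], [y] and [b], then the parameters of [f]. *)
pose s := scons (Add (Mul (Add (Var 2) (Var 0)) (Add (Var 2) (Var 0))) (Var 2))
                (fun k => Var k.+4).
pose F := fsubst s f.
pose B := fsubst (scons (Var 1) (fun=> Var 0)) fBit.
have sB (S : arith_structure) (x1 x2 : S) e' :
    sat (scons x1 (scons x2 e')) B <-> bit x2 x1.
  by rewrite /B; apply: iff_trans (sat_fsubst _ _ _) _; apply: sat_fBit.
have sF (S : arith_structure) (x1 x2 x3 x4 : S) e' :
    sat (scons x1 (scons x2 (scons x3 (scons x4 e')))) F <->
    sat (scons (pairA x3 x1) e') f.
  rewrite /F; apply: iff_trans (sat_fsubst _ _ _) _.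
  by rewrite (_ : (fun k => _) = scons (pairA x3 x1) e') //; apply/funext => -[].
have : sat (scons d (scons y (scons b e)))
    (All (Imp (fLt (Var 0) (Var 3)) (And (Imp B F) (Imp F B)))).
  by move=> w /hd h; split; [move/sB => ?; apply/sF/hf/h | move/sF/hf => ?; apply/sB/h].
move/(elementary1 j_el); rewrite !comp_scons => /(_ k kb) [h1 h2].
by split; [move/sB/h1/sF | move/sF/h2/sB].
Qed.

(** Countably many functions generate [M] and [N] from [I], and each of them yields
    one element outside [I].  If some [a] separates [I] from its complement, every
    element outside [I] is a value of such a function and lies above the
    element that belongs to it.  Otherwise, an element outside [I] and below
    all of these elements would have no new element of [N] below it. *)
Lemma extension_dcf : countably_generated_over I -> countably_generated_extension j ->
  dcf_is I [set: nat].
Proof.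
move=> [X cX genM] [Y cY genN].
have I0 : I 0 by exact: cut_0.
have I_exp := extension_exp_closed.
have I_pair x y : I x -> I y -> I (pairA x y) by apply: cut_pair.
case: (pselect (filling j)) => [[a ha]|nf].
  have [|//|T [hT Tall]] := @enum_dfun M _ (X `|` [set 0]) _ _; first by right.
    by apply: countable_setU => //; apply: countable1.
  have /choice[b hb] : forall n, exists b, ~ I b /\
      forall y, I y -> ~ I (T n y) -> b <= T n y.
    move=> n; have [x y Ix nIy|b nIb hb] := @values_outside a _ (T n) (hT n).
      by apply: ha; rewrite GI.
    by exists b.
  apply: (dcf_of_seq I_cut (b := b)) => [n|x nIx]; first by have [] := hb n.
  have [||t [y [ht Iy Ex]]] := @generated_values M _ I I0 I_pair (X `|` [set 0]) _ X _ genM x.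
  - by right.
  - by move=> z Xz; left.
  have [n En] := Tall t ht; exists n; have [_] := hb n => /(_ y Iy).
  by rewrite En -Ex; apply.
pose A := (Y `|` j @` X) `|` [set 0].
have A0 : A 0 by right.
have genN' : generates ((Y `|` j @` X) `|` j @` I).
  rewrite -setUA -image_setU; apply: generates_trans => //.
  by exists 0; right.
have jI_pair x y : (j @` I) x -> (j @` I) y -> (j @` I) (pairA x y).
  move=> [x' Ix <-] [y' Iy <-]; rewrite -(elem_pair j_el).
  by exists (pairA x' y') => //; apply: I_pair.
have [|T [hT Tall]] := enum_dfun A0.
  apply: countable_setU; last exact: countable1.
  apply: countable_setU => //; apply: sub_countable cX; exact: card_image_le.
have /choice[b hb] : forall n, exists b, ~ I b /\
    forall y, I y -> T n (j y) < j b -> range j (T n (j y)).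
  by move=> n; have [b nIb h] := small_values nf (hT n); exists b.
apply: (dcf_of_seq I_cut (b := b)) => [n|x nIx]; first by have [] := hb n.
apply: contrapT => nb; have [z zx] := new_below nIx; apply.
have [|t [_ [ht [y Iy <-] Ez]]] := generated_values (cut_0 image_cut) jI_pair A0 _ genN' z.
  by move=> w Aw; left.
have [n En] := Tall t ht; have [_ h] := hb n; rewrite Ez -En.
apply: h => //; rewrite En -Ez; apply: lea_lt_trans zx _; apply/(elem_lt j_el)/ltNge_a.
by move=> bx; apply: nb; exists n.
Qed.

End ExtensionToCut.

(** * Large homogeneous sequences *)

Section Ramsey.
Context (M : arith_structure) {HM : PA_model M}.
Implicit Types a b c e i k l m q r s t u v x y z : M.
Add Ring PA_ring : (PA_srt (M := M)).
Notation dpredT := (@dpred M setT).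

Definition inc s m := forall i k, i < k -> k < m -> at_ s i < at_ s k.
Definition mem s m x := exists i, i < m /\ at_ s i = x.
Definition subs s m t n := forall x, mem s m x -> mem t n x.

Lemma subs_trans t n s m r l : subs s m t n -> subs t n r l -> subs s m r l.
Proof. by move=> h h' x /h/h'. Qed.
Lemma mem_le s m n x : m <= n -> mem s m x -> mem s n x.
Proof. by move=> mn [i [im E]]; exists i; split=> //; apply: lta_le_trans im mn. Qed.
Lemma inc_le s m n : m <= n -> inc s n -> inc s m.
Proof. by move=> mn h i k ik km; apply: h => //; apply: lta_le_trans km mn. Qed.
Lemma inc_lt_inv s m i k : inc s m -> i < m -> at_ s i < at_ s k -> i < k.
Proof.
move=> h im hk; apply/ltNge_a => /lea_lt[ki|E].
  by apply: lta_irr (lta_trans hk (h _ _ ki im)).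
by move: hk; rewrite E => /lta_irr.
Qed.

Lemma seq_cat s u t : forall m, exists s', (forall i, i < u -> at_ s' i = at_ s i) /\
  (forall i, i < m -> at_ s' (u + i) = at_ t i).
Proof.
move=> m; pose F k := ifA (k < u) (at_ s k) (at_ t (mu (fun i => u + i = k))).
have [|s' hs'] := @seq_ex M _ F (u + m); first by rewrite /F; dfn_auto.
exists s'; split=> i im.
  by rewrite hs' /F ?ifT //; apply: lta_le_trans im _.
rewrite hs' /F; last by apply/ltaD2l.
rewrite ifF; last by move/ltNge_a; apply.
by congr at_; apply: mu_eq => k; split=> [/addaI|->].
Qed.

Lemma seq_rcons s u x : exists s', (forall i, i < u -> at_ s' i = at_ s i) /\
  at_ s' u = x.
Proof.
have [|t ht] := @seq_ex M _ (fun=> x) 1; first by dfn_auto.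
have [s' [h h']] := seq_cat s u t 1; exists s'; split=> //.
by rewrite -(adda0 u) h' ?ht.
Qed.

Lemma seq_shift s c m : exists s', forall i, i < m -> at_ s' i = at_ s (c + i).
Proof. by apply: seq_ex; dfn_auto. Qed.

Lemma inc_rcons s u x s' : inc s u -> (forall i, i < u -> at_ s i < x) ->
  (forall i, i < u -> at_ s' i = at_ s i) -> at_ s' u = x -> inc s' (u + 1).
Proof.
move=> su hx E Ex i k ik /ltaSle/lea_lt[ku|ku].
  by rewrite !E //; [apply: su|apply: lta_trans ik ku].
by rewrite ku Ex E; [apply: hx|]; rewrite -ku.
Qed.

(** The elements that satisfy [P] and those that do not are enumerated separately, and
    one of the two enumerations reaches half of the length. *)
Lemma split_seq (P : M -> Prop) s m : dpredT P -> inc s (m + m) ->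
  exists s', [/\ inc s' m, subs s' m s (m + m) &
    (forall x, mem s' m x -> P x) \/ (forall x, mem s' m x -> ~ P x)].
Proof.
move=> hP hs.
suff H t : t <= m + m -> exists u v a b, u + v = t /\ inc a u /\ inc b v /\
    (forall i, i < u -> P (at_ a i) /\ exists k, k < t /\ at_ s k = at_ a i) /\
    (forall i, i < v -> ~ P (at_ b i) /\ exists k, k < t /\ at_ s k = at_ b i).
  have [u [v [a [b [E [ia [ib [ha hb]]]]]]]] := H _ (lea_refl _).
  have [mu|vm] : m <= u \/ m <= v.
    case: (lta_total u m) => [um|]; [right|by left].
    apply/leNgt_a => vm; apply: (@lta_irr M (u + v)); rewrite {2}E.
    exact: ltaD um (ltaW vm).
  - exists a; split; first exact: inc_le mu ia.
      move=> _ [i [im <-]]; have [_ [k [km <-]]] := ha i (lta_le_trans im mu).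
      by exists k.
    by left=> _ [i [im <-]]; have [] := ha i (lta_le_trans im mu).
  - exists b; split; first exact: inc_le vm ib.
      move=> _ [i [im <-]]; have [_ [k [km <-]]] := hb i (lta_le_trans im vm).
      by exists k.
    by right=> _ [i [im <-]]; have [] := hb i (lta_le_trans im vm).
move: t; apply: PA_ind => [||t IH tm]; first by rewrite /inc; dfn_auto.
- move=> _; exists 0, 0, 0, 0; split; first by rewrite adda0.
  have inc0 : inc 0 0 by move=> i k _ /nlt0a.
  by do 2!split=> //; split=> i /nlt0a.
have tm' : t < m + m by apply/leSlt_a.
have [u [v [a [b [E [ia [ib [ha hb]]]]]]]] := IH (ltaW tm').
have weak x : (exists k, k < t /\ at_ s k = x) -> exists k, k < t + 1 /\ at_ s k = x.
  by move=> [k [kt h]]; exists k; split=> //; apply: lta_trans kt _.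
have below x : (exists k, k < t /\ at_ s k = x) -> x < at_ s t.
  by move=> [k [kt <-]]; apply: hs.
case: (pselect (P (at_ s t))) => Pt.
- have [a' [h1 h2]] := seq_rcons a u (at_ s t).
  exists (u + 1), v, a', b; split; first by rewrite -E; ring.
  split; first by apply: inc_rcons ia _ h1 h2 => i /ha[_ /below].
  split=> //; split=> [i /ltaSle/lea_lt[iu|->]|i /hb[? /weak]//].
    by rewrite h1 //; have [? /weak] := ha i iu.
  by rewrite h2; split=> //; exists t.
- have [b' [h1 h2]] := seq_rcons b v (at_ s t).
  exists u, (v + 1), a, b'; split; first by rewrite -E; ring.
  split=> //; split; first by apply: inc_rcons ib _ h1 h2 => i /hb[_ /below].
  split=> [i /ha[? /weak]//|i /ltaSle/lea_lt[iu|->]].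
    by rewrite h1 //; have [? /weak] := hb i iu.
  by rewrite h2; split=> //; exists t.
Qed.

(** Each of the [u] properties is made constant by one halving. *)
Lemma select_seq (psi : M -> M -> Prop) u m s : drel setT psi ->
  inc s (pow2 u * m) -> exists s', [/\ inc s' m, subs s' m s (pow2 u * m) &
    forall q x x', q < u -> mem s' m x -> mem s' m x' -> psi x q -> psi x' q].
Proof.
move=> hpsi hs.
suff : exists s', inc s' m /\ subs s' m s (pow2 u * m) /\
    forall q x x', q < u -> mem s' m x -> mem s' m x' -> psi x q -> psi x' q.
  by move=> [s' [h1 [h2 h3]]]; exists s'; split.
move: u m s hs; apply: PA_ind => [||u IH m s].
- by rewrite /inc /subs /mem; dfn_auto.
- move=> m s; rewrite pow2_0 mul1a => hs; exists s; do 2!split=> //.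
  by move=> q x x' /nlt0a.
have -> : pow2 (u + 1) * m = pow2 u * (m + m) by rewrite pow2_S; ring.
move=> /IH[s1 [inc1 [sub1 h1]]].
have [|s2 [inc2 sub2 h2]] := @split_seq (fun x => psi x u) s1 m _ inc1.
  by dfn_auto.
exists s2; split=> //; split; first exact: subs_trans sub1.
move=> q x x' /ltaSle/lea_lt[qu|->] sx sx'.
  by apply: h1 => //; apply: sub2.
by case: h2 => h2; [move=> _; apply: h2|move=> /(h2 _ sx)].
Qed.

(** ** Tuples of entries of a sequence *)

(** A number [q] written in base [k] encodes a tuple of [n] entries of [t] with
    indices below [k], followed by one more number. *)
Fixpoint tup (n : nat) t k q : nat -> M :=
  if n is n'.+1 then scons (at_ t (modA q k)) (tup n' t k (divA q k)) else fun=> q.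
Fixpoint rest (n : nat) k q : M := if n is n'.+1 then rest n' k (divA q k) else q.
Fixpoint bound (n : nat) k e : M := if n is n'.+1 then k * bound n' k e else e.

Lemma dff_tup (n : nat) (T K Q : (nat -> M) -> M) (i : nat) :
  dff setT T -> dff setT K -> dff setT Q -> dff setT (fun w => tup n (T w) (K w) (Q w) i).
Proof.
move=> hT hK; elim: n i Q => [|n IH] [|i] Q hQ //=; first by dfn_auto.
by apply: IH; dfn_auto.
Qed.
Lemma dff_rest (n : nat) (K Q : (nat -> M) -> M) :
  dff setT K -> dff setT Q -> dff setT (fun w => rest n (K w) (Q w)).
Proof.
by move=> hK; elim: n Q => [|n IH] Q hQ //=; apply: IH; dfn_auto.
Qed.

Lemma tup_ext n t t' k q : 0 < k -> (forall i, i < k -> at_ t i = at_ t' i) ->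
  tup n t k q = tup n t' k q.
Proof.
by move=> k0 h; elim: n q => //= n IH q; rewrite IH h //; apply: modA_lt.
Qed.

Lemma rest_bound n k q e : 0 < k -> rest n k q < e -> q < bound n k e.
Proof.
move=> k0; elim: n q => //= n IH q /IH /leSlt_a h.
rewrite {1}(divA_mod q k0); apply: lta_le_trans (leaM (lea_refl k) h).
have -> : k * (divA q k + 1) = divA q k * k + k by ring.
by apply/ltaD2l; apply: modA_lt.
Qed.

Lemma bound_le n k k' e : k <= k' -> bound n k e <= bound n k' e.
Proof. by move=> h; elim: n => //= n IH; apply: leaM. Qed.

(** Tuples are listed in decreasing order, because the induction on their length
    removes the largest entry, which thus is the head. *)
Fixpoint decr (S : M -> Prop) (xs : seq M) : Prop :=
  if xs is x :: ys then S x /\ decr (fun z => S z /\ z < x) ys else True.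

Lemma decr_mono (S S' : M -> Prop) xs : (forall x, S x -> S' x) -> decr S xs -> decr S' xs.
Proof.
elim: xs S S' => //= x xs IH S S' h [Sx d]; split; first exact: h.
by apply: IH d => z [/h].
Qed.

Lemma tup_ex t k xs y : 0 < k -> decr (mem t k) xs ->
  exists q, tup (size xs) t k q = foldr (@scons M) (fun=> y) xs /\
            rest (size xs) k q = y.
Proof.
move=> k0; elim: xs => [|x xs IH] /=; first by exists y.
move=> [[i [ik <-]] /(decr_mono (fun z (h : _ /\ _) => proj1 h))/IH[q [E1 E2]]].
exists (q * k + i); rewrite (modA_eq ik erefl) (divA_eq ik erefl) E1 E2.
by [].
Qed.

(** ** End-homogeneous sequences *)

Section EndHomogeneous.
Context (P : (nat -> M) -> Prop) (hP : dfn setT P) (n : nat).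

Let Phi x t k q := P (scons x (tup n t k q)).

Let dfn_Phi X T K Q : dff setT X -> dff setT T -> dff setT K -> dff setT Q ->
  dfn setT (fun w => Phi (X w) (T w) (K w) (Q w)).
Proof.
move=> hX hT hK hQ.
apply: (@dfn_ext M setT (fun w => P (fun i : nat => (match i with 0%N => X
   | i'.+1 => fun w => tup n (T w) (K w) (Q w) i' end) w))).
  move=> w; rewrite /Phi (_ : (fun _ => _) = scons (X w) (tup n (T w) (K w) (Q w))) //.
  by apply/funext => -[|i].
by apply: dfn_comp hP _ => -[|i] //; apply: dff_tup.
Qed.

(** End-homogeneity in the sense of Erdos and Rado: [P] does not depend on the largest
    entry of a tuple.  All the tuples below the [k]-th entry are covered at once,
    as [q] runs through their codes in base [k]; the condition [0 < k] keeps
    the digits meaningful and only exempts the first entry. *)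
Definition end_hom t e j l := forall k k' q, 0 < k -> k <= j -> k < k' -> k' < l ->
  rest n k q < e -> (Phi (at_ t k) t k q <-> Phi (at_ t k') t k q).

(** After [i] entries have been fixed, the later ones are candidates.  Fixing the next
    entry makes at most [u] properties of the candidates constant, which divides
    their number by [2 ^ u]; one more factor 2 pays for the entry itself. *)
Lemma end_hom_finite s b e : inc s b -> pow2 (e * (bound n e e + 1)) <= b ->
  exists t, [/\ inc t e, subs t e s b & end_hom t e e e].
Proof.
move=> hs; set u := bound n e e => hb.
suff H i : forall i', i + i' = e -> exists t,
    inc t (i + pow2 (i' * (u + 1))) /\ subs t (i + pow2 (i' * (u + 1))) s b /\
    end_hom t e i (i + pow2 (i' * (u + 1))).
  have [t [h1 [h2 h3]]] := H e 0 (adda0 e).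
  have le : e <= e + pow2 (0 * (u + 1)) by [].
  exists t; split; first exact: inc_le h1.
    by move=> x /(mem_le le)/h2.
  by move=> k k' q k0 ke kk' k'e; apply: h3 => //; apply: lta_le_trans k'e le.
move: i; apply: PA_ind => [||i IH i'].
- by rewrite /inc /subs /mem /end_hom; dfn_auto;
    first [apply: dff_rest | apply: dfn_Phi]; dfn_auto.
- move=> i'; rewrite !add0a => ->; exists s; split; first exact: inc_le hs.
  split; first by move=> x; apply: mem_le.
  by move=> k k' q k0 /lea0 k0'; move: k0; rewrite k0' => /lta_irr.
set r := pow2 (i' * (u + 1)) => Ei.
have [|t [inct [subt homt]]] := IH (i' + 1); first by rewrite -Ei; ring.
set R := pow2 _ in inct subt homt.
have r0 : 0 < r by apply: pow2_gt0.
have ER : R = pow2 u * r + pow2 u * r.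
  rewrite /R (_ : (i' + 1) * (u + 1) = i' * (u + 1) + u + 1); last by ring.
  by rewrite pow2_S pow2_D -/r; ring.
have lR : 1 + pow2 u * r <= R.
  rewrite ER; apply: leaD => //; rewrite -(add0a 1); apply/leSlt_a.
  by apply: gt0M => //; apply: pow2_gt0.
have in_t z : z < pow2 u * r -> i + 1 + z < i + R.
  move=> zr; rewrite -addaA; apply/ltaD2l; apply: lta_le_trans lR; exact/ltaD2l.
have [s1 hs1] := seq_shift t (i + 1) (pow2 u * r).
have inc1 : inc s1 (pow2 u * r).
  move=> p q pq qr; rewrite !hs1 //; last exact: lta_trans pq qr.
  by apply: inct; [apply/ltaD2l|apply: in_t].
have [|s2 [inc2 sub2 h2]] := @select_seq (fun x q => Phi x t (i + 1) q) u r s1 _ inc1.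
  by apply: dfn_Phi; dfn_auto.
have mem2 z : z < r -> exists w, [/\ i + 1 <= w, w < i + R & at_ t w = at_ s2 z].
  move=> zr; have [|v [vr Ev]] := sub2 (at_ s2 z); first by exists z.
  by exists (i + 1 + v); split=> //; [apply: in_t|rewrite -Ev hs1].
have [t' [ht1 ht2]] := seq_cat t (i + 1) s2 r.
have cases p : p < i + 1 + r -> p < i + 1 \/ exists2 z, z < r & p = i + 1 + z.
  move=> hp; case: (lta_total p (i + 1)) => [|/le_ex[z Ez]]; [by left|right].
  by exists z => //; move: hp; rewrite -Ez => /ltaD2l.
have iR : i + 1 <= i + R.
  by apply: leaD => //; apply: lea_trans lR.
(* Every entry of the new sequence is an entry of [t], at least as far on. *)
have entry p : p < i + 1 + r -> exists w, [/\ p < i + 1 /\ w = p \/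
    i + 1 <= p /\ i + 1 <= w, w < i + R & at_ t' p = at_ t w].
  move=> /cases[pi|[z zr ->]].
    by exists p; split; [left|apply: lta_le_trans pi iR|apply: ht1].
  have [w [w1 w2 w3]] := mem2 z zr; exists w; split=> //; first by right.
  by rewrite ht2.
exists t'; split.
  move=> p q pq qr; have pr : p < i + 1 + r by exact: lta_trans pq qr.
  case: (cases p pr) => [pi|[z zr Ez]].
    have [w [hw w2 ->]] := entry q qr; rewrite ht1 //; apply: inct => //.
    case: hw => [[_ ->]//|[_ iw]]; exact: lta_le_trans pi iw.
  case: (cases q qr) => [qi|[z' zr' Ez']].
    have : p < i + 1 by exact: lta_trans pq qi.
    by rewrite Ez => /ltNge_a[].
  by rewrite Ez Ez' !ht2 //; apply: inc2 => //; move: pq; rewrite Ez Ez' => /ltaD2l.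
split.
  move=> _ [p [pr <-]]; have [w [_ wR ->]] := entry p pr; apply: subt.
  by exists w.
move=> k k' q k0 /lea_lt[/ltaSle ki|Ek] kk' k'r hq.
  have ki' : k < i + 1 by apply/ltaSle.
  have -> : Phi (at_ t' k) t' k q = Phi (at_ t k) t k q.
    rewrite /Phi ht1 // (tup_ext n q k0 (t' := t)) // => x xk; apply: ht1.
    exact: lta_trans xk ki'.
  have [w [hw wR ->]] := entry k' k'r.
  have -> : Phi (at_ t w) t' k q = Phi (at_ t w) t k q.
    rewrite /Phi (tup_ext n q k0 (t' := t)) // => x xk; apply: ht1.
    exact: lta_trans xk ki'.
  apply: homt => //; case: hw => [[_ ->]//|[_ iw]]; exact: lta_le_trans ki' iw.
have [z zr Ez] : exists2 z, z < r & k' = i + 1 + z.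
  case: (cases k' k'r) => // h; exfalso; move: kk'; rewrite Ek.
  by move/lta_trans => /(_ _ h)/lta_irr.
have E x : Phi x t' k q = Phi x t (i + 1) q.
  rewrite /Phi -Ek (tup_ext n q k0 (t' := t)) // => y yk; apply: ht1.
  by rewrite -Ek.
have qu : q < u.
  apply: lta_le_trans (rest_bound k0 hq) _; apply: bound_le.
  by rewrite Ek -Ei.
have m1 : mem s2 r (at_ t' k) by exists 0; split=> //; rewrite -ht2 // adda0 Ek.
have m2 : mem s2 r (at_ t' k') by exists z; split=> //; rewrite Ez ht2.
by rewrite !E; split; apply: h2.
Qed.

Context (I : set M) (I_cut : is_cut I) (I_exp : exp_closed I).

(** Since [I] is exponentially closed, the finite version applies to every length in
    [I], and overspill gives a length outside. *)
Lemma end_hom_large s b : inc s b -> ~ I b ->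
  exists t e, [/\ inc t e, ~ I e, subs t e s b & end_hom t e e e].
Proof.
move=> hs nIb.
have [||e nIe [t [h1 [h2 h3]]]] := @overspill M _ I I_cut (fun e =>
   exists t, inc t e /\ subs t e s b /\ end_hom t e e e).
- by rewrite /inc /subs /mem /end_hom; dfn_auto;
    first [apply: dff_rest | apply: dfn_Phi]; dfn_auto.
- move=> e Ie; have [|t [h1 h2 h3]] := @end_hom_finite s b e hs; last by exists t.
  apply: ltaW; apply: (cut_lt I_cut) nIb; apply: cut_pow2 => //.
  have Iu : I (bound n e e).
    by elim: (n) => //= m IH; apply: cut_mul.
  by apply: cut_mul => //; apply: cut_S.
by exists t, e; split.
Qed.

End EndHomogeneous.

(** The argument of Erdos and Rado for Ramsey's theorem.  On an end-homogeneous
    sequence the largest component of a tuple may be replaced by the last entry,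
    which reduces the dimension by one.  The first entry, where end-homogeneity
    says nothing, and the last one are discarded. *)
Theorem ramsey (I : set M) (n : nat) (P : (nat -> M) -> Prop) s b :
  is_cut I -> exp_closed I -> dfn setT P -> inc s b -> ~ I b ->
  exists s' b', [/\ inc s' b', ~ I b', subs s' b' s b &
    forall xs xs' y, size xs = n -> size xs' = n ->
      decr (mem s' b') xs -> decr (mem s' b') xs' -> I y ->
      (P (foldr (@scons M) (fun=> y) xs) <-> P (foldr (@scons M) (fun=> y) xs'))].
Proof.
move=> I_cut I_exp; elim: n P s b => [|n IH] P s b hP hs nIb.
  exists s, b; split=> //.
  by move=> [|? ?] [|? ?] y.
have [t [e [inct nIe subt homt]]] := end_hom_large hP n I_cut I_exp hs nIb.
have [e1 nIe1 Ee] := cut_pred I_cut nIe.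
have [e2 nIe2 Ee1] := cut_pred I_cut nIe1.
have [s1 hs1] := seq_shift t 1 e2.
have in_t z : z < e2 -> 1 + z < e1 by rewrite Ee1 addaC => /ltaSS.
have e1e : e1 < e by rewrite Ee.
have inc1 : inc s1 e2.
  move=> p q pq qe; rewrite !hs1 //; last exact: lta_trans pq qe.
  by apply: inct; [apply/ltaD2l|apply: lta_trans (in_t _ qe) e1e].
have hP1 : dfn setT (fun env => P (scons (at_ t e1) env)).
  apply: (@dfn_ext M setT (fun w => P (fun i : nat => (match i with 0%N => fun=> at_ t e1
     | i'.+1 => fun w => w i' end) w))).
    by move=> w; rewrite (_ : (fun _ => _) = scons (at_ t e1) w) //;
      apply/funext => -[].
  by apply: dfn_comp hP _ => -[|i]; dfn_auto.
have [s' [b' [inc' nIb' sub' h]]] := IH _ s1 e2 hP1 inc1 nIe2.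
have in1 x : mem s' b' x -> exists k, [/\ 0 < k, k < e1 & at_ t k = x].
  move=> /sub'[k [ke <-]]; exists (1 + k); split; last by rewrite hs1.
    by rewrite addaC.
  exact: in_t.
exists s', b'; split=> //.
  apply: subs_trans sub' _; apply: subs_trans _ subt => _ [k [ke <-]].
  by exists (1 + k); split; [apply: lta_trans (in_t _ ke) e1e|rewrite hs1].
suff H x xs y : size xs = n -> decr (mem s' b') (x :: xs) -> I y ->
    P (foldr (@scons M) (fun=> y) (x :: xs)) <->
    P (scons (at_ t e1) (foldr (@scons M) (fun=> y) xs)).
  move=> [//|x xs] [//|x' xs'] y [sz] [sz'] d d' Iy.
  rewrite (H x) // (H x') //; apply: h => //.
  - by case: d => _; apply: decr_mono => z [].
  - by case: d' => _; apply: decr_mono => z [].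
move=> sz /= [sx d] Iy; have [k [k0 ke Ek]] := in1 x sx.
have ke' : k < e by apply: lta_trans ke e1e.
have {}d : decr (mem t k) xs.
  apply: decr_mono d => z [/in1[i [_ ie Ei]] zx]; exists i; split=> //.
  apply: (inc_lt_inv inct); first exact: lta_trans ie e1e.
  by rewrite Ei Ek.
have [q [Eq Er]] := tup_ex y k0 d; rewrite sz in Eq Er.
rewrite -Eq -Ek; apply: homt => //; first exact: ltaW.
by rewrite Er; apply: cut_lt nIe.
Qed.

End Ramsey.

(** * A descending chain of large homogeneous sets *)

Section Chain.
Context (M : arith_structure) {HM : PA_model M}.
Context (I : set M) (I_cut : is_cut I) (I_exp : exp_closed I).

(** The tail of the environment is constantly [y]: homogeneity is uniform over the
    parameters from [I]. *)
Definition homogeneous (n : nat) (P : (nat -> M) -> Prop) (s l : M) :=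
  forall xs xs' y, size xs = n -> size xs' = n ->
    decr (mem s l) xs -> decr (mem s l) xs' -> I y ->
    (P (foldr (@scons M) (fun=> y) xs) <-> P (foldr (@scons M) (fun=> y) xs')).

Lemma homogeneous_sub n P s l s' l' : subs s' l' s l ->
  homogeneous n P s l -> homogeneous n P s' l'.
Proof.
move=> h hom xs xs' y sz sz' d d'; apply: hom => //; exact: decr_mono h _.
Qed.

Lemma chain_step n P s l b : dfn setT P -> inc s l -> ~ I l -> ~ I b ->
  exists s' l', [/\ inc s' l', ~ I l', subs s' l' s l, l' <= b & homogeneous n P s' l'].
Proof.
move=> hP hs nl nb.
have [s' [l' [inc' nl' sub' hom']]] := ramsey n I_cut I_exp hP hs nl.
case: (lta_total l' b) => [/ltaW h|h]; first by exists s', l'; split.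
exists s', b; split=> //; first exact: inc_le inc'.
  by apply: subs_trans sub' => x; apply: mem_le.
by apply: homogeneous_sub hom' => x; apply: mem_le.
Qed.

Context (X : set M) (cX : countable X) (genM : generates (X `|` I)).
Context (b : nat -> M) (bI : forall n, ~ I (b n)).

(** Uncountably many definable relations are handled in countably many steps: all
    the parameters of a relation are values, at a common argument in [I], of
    functions from a countable list, and homogeneity is uniform in [I]. *)
Lemma homogeneous_chain : exists s l : nat -> M,
  [/\ forall k, inc (s k) (l k), forall k, ~ I (l k),
      forall k, subs (s k.+1) (l k.+1) (s k) (l k), forall k, l k.+1 <= b k
    & forall n P, dfn setT P -> exists k, homogeneous n P (s k) (l k)].
Proof.
have I0 : I 0 by exact: cut_0.
pose A := X `|` [set (0 : M)].
have A0 : A 0 by right.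
have [|T [hT Tall]] := enum_dfun A0.
  by apply: countable_setU => //; apply: countable1.
(* The variables below [n] are the arguments; variable [n] is a pair, whose second
   component is the parameter [y] and from which the [T]s compute the others. *)
pose G n (ns : seq nat) (k : nat) : (nat -> M) -> M :=
  if (k < n)%N then fun w => w k else
  if k == n then fun w => sndA (w n) else fun w => T (nth 0%N ns (k - n.+1)) (w n).
have hG n ns k : dff setT (G n ns k).
  rewrite /G; case: (k < n)%N; first by dfn_auto.
  case: eqP => _; first by dfn_auto.
  by have h := hT (nth 0%N ns (k - n.+1)); dfn_auto.
pose idx m := enum_formula (0%N, [::] : seq nat) m.
pose Q m (w : nat -> M) := sat ((G (idx m).2.1 (idx m).2.2)^~ w) (idx m).1.
have hQ m : dfn setT (Q m) by apply: dfn_sat => k; apply: hG.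
pose large (p : M * M) := inc p.1 p.2 /\ ~ I p.2.
have /choice[step hstep] : forall mp : nat * {p | large p}, exists p' : {p | large p},
    let: (m, exist p _) := mp in let: exist p' _ := p' in
    [/\ subs p'.1 p'.2 p.1 p.2, p'.2 <= b m & homogeneous (idx m).2.1 (Q m) p'.1 p'.2].
  move=> [m [[s l] [/= hs nl]]].
  have [s' [l' [h1 h2 h3 h4 h5]]] := chain_step (idx m).2.1 (hQ m) hs nl (bI (n := m)).
  by exists (exist _ (s', l') (conj h1 h2)).
have [s0 hs0] := @seq_ex M _ id (b 0) ltac:(by dfn_auto).
have large0 : large (s0, b 0).
  split=> //= i k ik kb; rewrite !hs0 //; exact: lta_trans ik kb.
pose chain := fix chain k : {p | large p} :=
  if k is k'.+1 then step (k', chain k') else exist _ _ large0.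
pose s k := (proj1_sig (chain k)).1; pose l k := (proj1_sig (chain k)).2.
have hchain k : [/\ subs (s k.+1) (l k.+1) (s k) (l k), l k.+1 <= b k &
    homogeneous (idx k).2.1 (Q k) (s k.+1) (l k.+1)].
  rewrite /s /l /=; have := hstep (k, chain k).
  by case: (chain k) => p hp; case: (step _).
exists s, l; split.
- by move=> k; rewrite /s /l; case: (chain k) => p [].
- by move=> k; rewrite /s /l; case: (chain k) => p [].
- by move=> k; have [] := hchain k.
- by move=> k; have [] := hchain k.
move=> n P hP.
have hP' : dfn setT (fun w => P (fun k => w (minn k n))).
  exact: dfn_ext (dfn_slot (t := fun k => inl (minn k n)) _ hP).
have [f [e [_ hf]]] := dfn_formula n.+1 (A := setT) Logic.I hP'.
have I_pair x y : I x -> I y -> I (pairA x y) by apply: cut_pair.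
have eA k : exists t y, [/\ dfun A t, I y & e k = t y].
  by apply: (generated_values I0 I_pair A0 _ genM) => x Xx; left.
have [t [y0 [Iy0 tA ht]]] := common_argument I0 I_pair (fbound f) eA.
have /choice[c hc] : forall k, exists m, T m = fun y => t k (fstA y).
  by move=> k; apply: Tall; have h := tA k; dfn_auto.
have [m Em] := enum_formulaP (0%N, [::] : seq nat) f (n, mkseq c (fbound f)).
exists m.+1; have [_ _] := hchain m; rewrite /Q /idx Em /= => hom.
move=> xs xs' y sz sz' d d' Iy.
have E zs : size zs = n -> P (foldr (@scons M) (fun=> y) zs) <->
    sat (fun k => G n (mkseq c (fbound f)) k
           (foldr (@scons M) (fun=> pairA y0 y) zs)) f.
  move=> szs.
  have -> : foldr (@scons M) (fun=> y) zs =
     (fun k => foldr (@scons M) (fun=> 0) (rcons zs y) (minn k n)).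
    apply/funext => k; rewrite -cats1 foldr_cat /=.
    case: (ltnP k n) => [kn|nk].
      by apply: foldr_scons_lt; rewrite szs.
    rewrite -(subnKC nk) -szs foldr_scons_ge.
    by rewrite foldr_scons_size.
  rewrite hf ?size_rcons ?szs //; apply: sat_fbound => k kb.
  rewrite -cats1 foldr_cat /= /G; case: ltnP => [kn|nk].
    by apply: foldr_scons_lt; rewrite szs.
  case: eqP => [->|/eqP kn].
    by rewrite -szs !foldr_scons_size sndA_pair.
  have {nk}nk : (n < k)%N by rewrite ltn_neqAle eq_sym kn.
  have kb' : (k - n.+1 < fbound f)%N by apply: leq_ltn_trans (leq_subr _ _) kb.
  rewrite nth_mkseq // hc -[X in foldr _ _ _ X = _](subnKC nk) -szs addSnnS.
  by rewrite foldr_scons_ge /= foldr_scons_size fstA_pair ht // szs.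
by rewrite E // E //; apply: hom => //; apply: I_pair.
Qed.

End Chain.

(** * The definable ultrapower along a chain *)

Section Ultrapower.
Context (M : arith_structure) {HM : PA_model M}.
Context (I : set M) (I_cut : is_cut I).
Context (s l : nat -> M).
Context (s_inc : forall k, inc (s k) (l k)) (l_out : forall k, ~ I (l k)).
Context (s_sub : forall k, subs (s k.+1) (l k.+1) (s k) (l k)).
Context (s_hom : forall n P, dfn setT P -> exists k, homogeneous I n P (s k) (l k)).

(** The sets that contain a member of the chain; among the definable sets they form an
    ultrafilter. *)
Definition big (A : M -> Prop) := exists k, forall x, mem (s k) (l k) x -> A x.

Lemma s_mono k k' : (k <= k')%N -> subs (s k') (l k') (s k) (l k).
Proof.
elim: k' => [|k' IH]; first by rewrite leqn0 => /eqP ->.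
rewrite leq_eqVlt => /orP[/eqP -> //|/IH]; exact: subs_trans.
Qed.

Lemma s_two k : exists x y, [/\ mem (s k) (l k) x, mem (s k) (l k) y & x <> y].
Proof.
have I0 : I 0 by exact: cut_0.
have l1 : 1 < l k by apply: (cut_lt I_cut) => //; rewrite -(add0a 1); apply: cut_S.
have l0 : 0 < l k by apply: (cut_lt I_cut).
exists (at_ (s k) 0), (at_ (s k) 1); split; [by exists 0|by exists 1|].
by case: (s_inc lt01 l1).
Qed.

Lemma big_true A : (forall x, A x) -> big A.
Proof. by move=> h; exists 0%N. Qed.
Lemma big_imp (A B : M -> Prop) : (forall x, A x -> B x) -> big A -> big B.
Proof. by move=> h [k hk]; exists k => x /hk/h. Qed.
Lemma big_and A B : big A -> big B -> big (fun x => A x /\ B x).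
Proof.
move=> [k hk] [k' hk']; exists (maxn k k') => x hx; split.
- by apply: hk; apply: s_mono hx; apply: leq_maxl.
- by apply: hk'; apply: s_mono hx; apply: leq_maxr.
Qed.
Lemma big_ex A : big A -> exists x, A x.
Proof. by move=> [k hk]; have [x [_ [hx _ _]]] := s_two k; exists x; apply: hk. Qed.
Lemma big_const P : big (fun=> P) <-> P.
Proof. by split=> [/big_ex[]//|p]; apply: big_true. Qed.
Lemma big_iff (A B : M -> Prop) : (forall x, A x <-> B x) -> big A <-> big B.
Proof. by move=> h; split; apply: big_imp => x /h. Qed.
Lemma big_congr (E A B : M -> Prop) : big E -> (forall x, E x -> (A x <-> B x)) ->
  big A <-> big B.
Proof.
by move=> bE h; split=> /(big_and bE); apply: big_imp => x [/h E']; rewrite E'.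
Qed.
Lemma big_all (A : nat -> M -> Prop) n : (forall k, big (A k)) ->
  big (fun x => forall k, (k < n)%N -> A k x).
Proof.
move=> h; elim: n => [|n IH]; first by apply: big_true.
apply: big_imp (big_and IH (h n)) => x [h1 h2] k.
by rewrite ltnS leq_eqVlt => /orP[/eqP ->|/h1].
Qed.

(** This uniformity in [y] is what makes types over [M] agree with coded sets on
    [I]. *)
Lemma decided (R : M -> M -> Prop) : drel setT R -> exists k, forall y, I y ->
  (forall x, mem (s k) (l k) x -> R x y) \/ (forall x, mem (s k) (l k) x -> ~ R x y).
Proof.
move=> hR; have [k hom] := s_hom 1 hR; exists k => y Iy.
have E x x' : mem (s k) (l k) x -> mem (s k) (l k) x' -> (R x y <-> R x' y).
  by move=> hx hx'; apply: (hom [:: x] [:: x'] y).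
case: (pselect (exists2 x, mem (s k) (l k) x & R x y)) => [[x hx Rx]|n].
  by left=> x' hx'; apply/(E x).
by right=> x hx Rx; apply: n; exists x.
Qed.

Lemma big_ultra (A : M -> Prop) : dpred setT A -> big A \/ big (fun x => ~ A x).
Proof.
move=> hA; have [|k h] := @decided (fun x _ => A x); first by dfn_auto.
by case: (h 0 (cut_0 I_cut)) => h'; [left|right]; exists k.
Qed.

Lemma big_not (A : M -> Prop) : dpred setT A -> (~ big A <-> big (fun x => ~ A x)).
Proof.
move=> hA; split=> [|h h']; first by case: (big_ultra hA).
by have [x []] := big_ex (big_and h h').
Qed.

Definition fns := {f : M -> M | dfun setT f}.
Definition app (f : fns) : M -> M := proj1_sig f.
Lemma appP f : dfun setT (app f). Proof. exact: proj2_sig f. Qed.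
Hint Resolve appP : core.
Lemma dfun_cst (m : M) : dfun setT (fun=> m). Proof. by dfn_auto. Qed.
Lemma dfun_id : dfun setT (@id M). Proof. by dfn_auto. Qed.
Definition cst (m : M) : fns := exist _ _ (dfun_cst m).
Definition idf : fns := exist _ _ dfun_id.

Definition equ (f g : fns) := big (fun x => app f x = app g x).
Lemma equ_refl f : equ f f. Proof. exact: big_true. Qed.
Lemma equ_sym f g : equ f g -> equ g f. Proof. exact: big_imp. Qed.
Lemma equ_trans f g h : equ f g -> equ g h -> equ f h.
Proof. by move=> h1 h2; apply: big_imp (big_and h1 h2) => x [-> ->]. Qed.

Definition ultra := {C : set fns | exists f, C = equ f}.
Definition cls (f : fns) : ultra := exist _ (equ f) (ex_intro _ f erefl).
Definition rep (C : ultra) : fns := projT1 (cid (proj2_sig C)).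

Lemma cls_eq f g : cls f = cls g <-> equ f g.
Proof.
split=> [[E]|h]; first by rewrite -/(equ f g) E; apply: equ_refl.
have E : equ f = equ g.
  apply/funext => u; apply/propext; split; first exact: equ_trans (equ_sym h).
  exact: equ_trans h.
rewrite /cls; move: (ex_intro _ f _) (ex_intro _ g _); rewrite E => p q.
by congr exist; apply: Prop_irrelevance.
Qed.
Lemma cls_rep C : cls (rep C) = C.
Proof.
case: C => C hC; rewrite /rep /=; case: cid => f /= E; subst C.
by congr exist; apply: Prop_irrelevance.
Qed.
Lemma rep_cls f : equ (rep (cls f)) f.
Proof. by apply/cls_eq; rewrite cls_rep. Qed.

Definition lift2 (op : M -> M -> M)
    (hop : forall f g, dfun setT f -> dfun setT g -> dfun setT (fun x => op (f x) (g x)))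
    (C D : ultra) : ultra :=
  cls (exist _ _ (hop _ _ (appP (rep C)) (appP (rep D)))).

Lemma dfun_add f g : dfun setT f -> dfun setT g -> dfun setT (fun x : M => f x + g x).
Proof. by move=> hf hg; dfn_auto. Qed.
Lemma dfun_mul f g : dfun setT f -> dfun setT g -> dfun setT (fun x : M => f x * g x).
Proof. by move=> hf hg; dfn_auto. Qed.

Definition ultrapower := @ArithStructure ultra (cls (cst 0)) (cls (cst 1))
  (lift2 dfun_add) (lift2 dfun_mul)
  (fun C D => big (fun x => app (rep C) x <= app (rep D) x)).

Let app_rep (f : fns) : big (fun x => app (rep (cls f)) x = app f x) := rep_cls f.

Let lift2_rep op hop C D :
  big (fun x => app (rep (@lift2 op hop C D)) x = op (app (rep C) x) (app (rep D) x)).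
Proof. exact: app_rep. Qed.

Lemma eval_rep (e : nat -> ultrapower) t :
  big (fun x => app (rep (eval e t)) x = eval (fun k => app (rep (e k)) x) t).
Proof.
elim: t => /= [k|||t1 IH1 t2 IH2|t1 IH1 t2 IH2].
- exact: big_true.
- exact: app_rep.
- exact: app_rep.
- have h := lift2_rep dfun_add (eval e t1) (eval e t2).
  by apply: big_imp (big_and h (big_and IH1 IH2)) => x [-> [-> ->]].
- have h := lift2_rep dfun_mul (eval e t1) (eval e t2).
  by apply: big_imp (big_and h (big_and IH1 IH2)) => x [-> [-> ->]].
Qed.

Let dsat (g : nat -> fns) f : dpred setT (fun x => sat (fun k => app (g k) x) f).
Proof.
rewrite /dpred; apply: (dfn_sat (G := fun k w => app (g k) (w 0%N))) => k.
exact: appP.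
Qed.

Let witness (g : nat -> fns) f : exists h : fns, forall x,
  (exists z, sat (scons z (fun k => app (g k) x)) f) ->
  sat (scons (app h x) (fun k => app (g k) x)) f.
Proof.
have hh : dfun setT (fun x => mu (fun z => sat (scons z (fun k => app (g k) x)) f)).
  rewrite /dfun; apply: dff_mu.
  apply: (@dfn_ext M _ (fun w => sat (fun k => (if k is k'.+1 then
      fun w : nat -> M => app (g k') (w 1%N) else fun w : nat -> M => w 0%N) w) f)).
    move=> w; rewrite (_ : (fun k => _) = scons (w 0%N) (fun k => app (g k) (w 1%N))) //.
    by apply/funext => -[|k].
  apply: dfn_sat => -[|k]; first by dfn_auto.
  by have h := appP (g k); dfn_auto.
exists (exist _ _ hh) => x [z hz] /=.
exact: (muP (P := fun z => sat (scons z (fun k => app (g k) x)) f) (dpred_sat _ _) hz).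
Qed.

Let scons_rep (C : ultrapower) (e : nat -> ultrapower) x :
  (fun k => app (rep (scons C e k)) x) = scons (app (rep C) x) (fun k => app (rep (e k)) x).
Proof. by apply/funext => -[|k]. Qed.

Let los_ex f (e : nat -> ultrapower) :
  (forall e' : nat -> ultrapower,
     sat e' f <-> big (fun x => sat (fun k => app (rep (e' k)) x) f)) ->
  (exists C : ultrapower, sat (scons C e) f) <->
  big (fun x => exists z, sat (scons z (fun k => app (rep (e k)) x)) f).
Proof.
move=> IH; split=> [[C /IH]|h].
  by apply: big_imp => x; rewrite scons_rep => hx; exists (app (rep C) x).
have [w hw] := witness (fun k => rep (e k)) f.
exists (cls w); apply/IH; apply: big_imp (big_and (app_rep w) h) => x [E hx].
by rewrite scons_rep E; apply: hw.
Qed.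

Lemma los_rep f (e : nat -> ultrapower) :
  sat e f <-> big (fun x => sat (fun k => app (rep (e k)) x) f).
Proof.
elim: f e => /=.
- move=> t1 t2 e; have := cls_eq (rep (@eval ultrapower e t1)) (rep (@eval ultrapower e t2)).
  rewrite !cls_rep => ->.
  apply: big_congr (big_and (eval_rep e t1) (eval_rep e t2)) _ => x [-> ->].
  by [].
- move=> t1 t2 e.
  by apply: big_congr (big_and (eval_rep e t1) (eval_rep e t2)) _ => x [-> ->].
- move=> f IH e; rewrite IH; apply: big_not; exact: dsat.
- move=> f IHf g IHg e; rewrite IHf IHg; split=> [[]|]; first exact: big_and.
  by move=> h; split; apply: big_imp h => x [].
- move=> f IHf g IHg e; rewrite IHf IHg; split.
    by case; apply: big_imp; [left|right].
  have := big_ultra (dsat (fun k => rep (e k)) f) => -[|h]; first by left.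
  by move=> /(big_and h) h'; right; apply: big_imp h' => x [? []].
- move=> f IHf g IHg e; rewrite IHf IHg; split; last first.
    by move=> h /(big_and h); apply: big_imp => x [h' /h'].
  have := big_ultra (dsat (fun k => rep (e k)) f) => -[h /(_ h)|h _].
    by apply: big_imp.
  by apply: big_imp h.
- move=> f IH e; split=> [h|h C]; last first.
    by apply/IH; apply: big_imp h => x; rewrite scons_rep.
  have [||] := @big_ultra (fun x => forall z, sat (scons z (fun k => app (rep (e k)) x)) f).
  + exact: (dsat (fun k => rep (e k)) (All f)).
  + by [].
  move=> h'; exfalso.
  have : exists C : ultrapower, sat (scons C e) (Not f).
    apply/los_ex; last first.
      apply: big_imp h' => x nx; apply: contrapT => nz; apply: nx => z.
      by apply: contrapT => hz; apply: nz; exists z.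
    by move=> e' /=; rewrite IH; apply: big_not; apply: dsat.
  by case=> C; apply; apply: h.
- by move=> f IH e; apply: los_ex.
Qed.

(** Los's theorem.  Representatives may be chosen freely, because a formula involves
    only finitely many of the classes. *)
Lemma los f (g : nat -> fns) :
  sat (fun k => cls (g k) : ultrapower) f <-> big (fun x => sat (fun k => app (g k) x) f).
Proof.
rewrite los_rep; apply: big_congr (big_all (fbound f) (fun k => app_rep (g k))) _.
by move=> x h; apply: sat_fbound.
Qed.

Lemma ultra_cls (e : nat -> ultrapower) : exists g : nat -> fns, e = fun k => cls (g k).
Proof. by exists (fun k => rep (e k)); apply/funext => k; rewrite cls_rep. Qed.

Definition diag (m : M) : ultrapower := cls (cst m).

Lemma diag_elementary : elementary diag.
Proof.
move=> f e; rewrite (los f (fun k => cst (e k))); symmetry; exact: (big_const (sat e f)).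
Qed.

Lemma cls_le f g : (cls f : ultrapower) <= cls g <-> big (fun x => app f x <= app g x).
Proof.
exact: (los (Le (Var 0) (Var 1)) (fun k => if k is 0%N then f else g)).
Qed.
Lemma cls_lt f g : (cls f : ultrapower) < cls g <-> big (fun x => app f x < app g x).
Proof.
exact: (los (fLt (Var 0) (Var 1)) (fun k => if k is 0%N then f else g)).
Qed.
Lemma cls_diag f m : (cls f : ultrapower) = diag m <-> big (fun x => app f x = m).
Proof. exact: cls_eq. Qed.

(** A function that represents an element of [M] is constant on some member of the
    chain, and every member has two elements. *)
Lemma cls_new (f : fns) k : (forall x y, mem (s k) (l k) x -> mem (s k) (l k) y ->
    app f x = app f y -> x = y) -> ~ range diag (cls f).
Proof.
move=> inj [m _ /esym/cls_diag[k' h]].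
have [x [y [hx hy]]] := s_two (maxn k k'); apply.
have hx1 := s_mono (leq_maxl k k') hx; have hy1 := s_mono (leq_maxl k k') hy.
have hx2 := s_mono (leq_maxr k k') hx; have hy2 := s_mono (leq_maxr k k') hy.
by apply: inj => //; rewrite h // h.
Qed.

Lemma ultra_cofinal : cofinal_extension diag.
Proof.
split.
  split; first exact: diag_elementary.
  move=> E; case: (@cls_new idf 0%N) => //; by rewrite E.
move=> C; rewrite -(cls_rep C); set f := rep C.
have [|B hB] := @dfun_bounded M _ (fun i => app f (at_ (s 0%N) i)) (l 0%N).
  have h := appP f; dfn_auto.
exists B; apply/cls_le; exists 0%N => _ [i [il <-]]; exact: hB.
Qed.

(** A definable function [f] is defined by a formula that also defines its class from
    the class of the identity. *)
Lemma ultra_generated : generated_by diag (cls idf : ultrapower).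
Proof.
move=> [K [k [[k_el k_proper] sub]]]; apply: k_proper; apply/seteqP; split=> // C _.
rewrite -(cls_rep C); set f := rep C.
have [phi [e [_ h]]] := dfn_formula 2 (A := setT) Logic.I (appP f).
apply: (@range_definable _ _ k phi (scons (cls idf : ultrapower) (diag \o e))) => //.
  move=> [|i]; first by apply: sub; right.
  by apply: sub; left; exists (e i).
move=> D; rewrite -[D]cls_rep; set g := rep D.
pose G i := if i is i'.+1 then if i' is i''.+1 then cst (e i'') else idf else g.
have -> : scons (cls g : ultrapower) (scons (cls idf : ultrapower) (diag \o e)) =
    fun i => cls (G i).
  by apply/funext => -[|[|i]].
rewrite los cls_eq; apply: big_iff => x.
rewrite (_ : (fun i => _) = scons (app g x) (scons x e)); last first.
  by apply/funext => -[|[|i]].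
exact: iff_sym (h [:: app g x; x] erefl).
Qed.

(** The index of a point in the enumeration of a member of the chain is bounded by the
    length of that member; so short members give small new elements. *)
Lemma new_index k (f := fun x => mu (fun i => i < l k /\ at_ (s k) i = x)) :
  exists2 C : ultrapower, C <= diag (l k) & ~ range diag C.
Proof.
have hf : dfun setT f by rewrite /f; dfn_auto.
have fP x : mem (s k) (l k) x -> f x < l k /\ at_ (s k) (f x) = x.
  by move=> [i h]; apply: (muP (P := fun i => i < l k /\ at_ (s k) i = x) _ h); dfn_auto.
exists (cls (exist _ f hf)).
  by apply/cls_le; exists k => x /fP[/ltaW].
apply: (@cls_new _ k) => x y /fP[_ Ex] /fP[_ Ey] /= E.
by rewrite -Ex E Ey.
Qed.

(** All the equations [f x = y] with [y] in [I] are decided by one member of the chain,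
    and one of them holds. *)
Lemma bounded_value (C : ultrapower) b : I b -> C <= diag b -> exists2 m, m <= b & C = diag m.
Proof.
rewrite -(cls_rep C); set f := rep C => Ib /cls_le hb.
have [|k hk] := @decided (fun x y => app f x = y).
  by have h := appP f; dfn_auto.
have bk : big (fun x => mem (s k) (l k) x) by exists k.
have [x [xb hx]] := big_ex (big_and hb bk).
exists (app f x) => //; apply/cls_diag; exists k.
by case: (hk (app f x) (cut_le I_cut Ib xb)) => // /(_ x hx)[].
Qed.

Lemma ultra_GCIS : (forall x, ~ I x -> exists k, l k <= x) -> GCIS diag = I.
Proof.
move=> hl; apply/seteqP; split=> b; rewrite /GCIS /=; last first.
  move=> Ib; apply/seteqP; split=> [_ [x xb <-]|C /(bounded_value Ib)[m mb ->]].
    by apply/(elem_le diag_elementary).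
  by exists m.
move=> E; apply: contrapT => /hl[k lb]; have [C Cl] := new_index k; apply.
have : [set y | y <= diag b] C.
  have HN := elementary_PA diag_elementary HM.
  by apply: lea_trans Cl _; apply/(elem_le diag_elementary).
by rewrite -E => -[x _ <-]; exists x.
Qed.

(** If [f] exceeds every element of [I] on a member of the chain, so does its least
    value there. *)
Lemma ultra_not_filling : GCIS diag = I -> ~ filling diag.
Proof.
move=> E [C]; rewrite E -(cls_rep C); set f := rep C => hC.
have [|k hk] := @decided (fun x y => app f x <= y).
  by have h := appP f; dfn_auto.
have gt y x : I y -> mem (s k) (l k) x -> y < app f x.
  move=> Iy hx; case: (hk y Iy) => h; last by apply/ltNge_a; apply: h.
  have [z nIz] := cut_out I_cut; have [/cls_lt[k' h'] _] := hC y z Iy nIz.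
  have [w [_ [hw _ _]]] := s_two (maxn k k').
  have := h' w (s_mono (leq_maxr k k') hw) => /ltNge_a[].
  by apply: h; apply: s_mono hw; apply: leq_maxl.
have [x [_ [hx _ _]]] := s_two k.
pose V v := exists2 x, mem (s k) (l k) x & app f x = v.
have hV : dpred setT V.
  rewrite /dpred; apply: (@dfn_ext M _ (fun w => exists x, mem (s k) (l k) x /\ app f x = w 0%N)).
    by move=> w; split=> [[z [? ?]]|[z ? ?]]; exists z.
  by rewrite /mem; have h := appP f; dfn_auto.
have [[x0 hx0 E0] hmin] := mu_least hV (ex_intro2 _ _ x hx erefl : V (app f x)).
have nI : ~ I (mu V) by move=> Im; have := gt _ _ Im hx0; rewrite E0 => /lta_irr.
have [_ /cls_lt[k' h]] := hC 0 (mu V) (cut_0 I_cut) nI.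
have [w [_ [hw _ _]]] := s_two (maxn k k').
have := h w (s_mono (leq_maxr k k') hw) => /ltNge_a[].
by apply: hmin; exists w => //; apply: s_mono hw; apply: leq_maxl.
Qed.

(** The trace on [I] of a set definable in the ultrapower is decided by one member of
    the chain, so any point of that member defines it in [M]. *)
Lemma ultra_same_Cod : same_Cod diag I.
Proof.
apply/seteqP; split=> [_ [_ [[f e] ->] <-]|_ [_ [_ [[f e] ->] <-] <-]]; last first.
  exists [set x | sat_over id (f, diag \o e) [:: x]]; first by exists (f, diag \o e).
  apply/seteqP; split=> [_ [[y Iy <-]]|_ [y [Iy hy] <-]].
    by rewrite /sat_over /= => h; exists y => //; split=> //; apply/(elementary1 diag_elementary).
  by split; [exists y|rewrite /sat_over /=; apply/(elementary1 diag_elementary)].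
have [g ->] := ultra_cls e.
pose R x y := sat (scons y (fun k => app (g k) x)) f.
have hR : drel setT R.
  rewrite /drel /R; apply: (@dfn_ext M _ (fun w => sat (fun k => (if k is k'.+1 then
      fun w : nat -> M => app (g k') (w 0%N) else fun w : nat -> M => w 1%N) w) f)).
    move=> w; rewrite (_ : (fun k => _) = scons (w 1%N) (fun k => app (g k) (w 0%N))) //.
    by apply/funext => -[|k].
  by apply: dfn_sat => -[|k]; [|have h := appP (g k)]; dfn_auto.
have [k hk] := decided hR; have [x0 [_ [hx0 _ _]]] := s_two k.
have E y : I y -> sat (scons (diag y) (fun k => cls (g k) : ultrapower)) f <-> R x0 y.
  move=> Iy; pose G i := if i is i'.+1 then g i' else cst y.
  have -> : scons (diag y) (fun k => cls (g k) : ultrapower) = fun i => cls (G i).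
    by apply/funext => -[].
  rewrite los (_ : (fun x => _) = fun x => R x y); last first.
    apply/funext => x; rewrite /R; congr (sat _ f); by apply/funext => -[].
  case: (hk y Iy) => h; split=> [b|h'].
  - exact: h.
  - by exists k.
  - have bk : big (fun x => mem (s k) (l k) x) by exists k.
    by have [x [Rx /h]] := big_ex (big_and b bk).
  - by case: (h x0 hx0).
exists (I `&` [set y | R x0 y]).
  exists [set y | R x0 y] => //; apply: dpred_Def.
  apply: (@dfn_app2 M setT R (fun=> x0) (fun w => w 0%N)) => //; dfn_auto.
rewrite /sat_over /=; apply/seteqP; split=> [_ [y [Iy hy] <-]|_ [[y Iy <-] hy]].
  by split; [exists y|apply/E].
by exists y => //; split=> //; apply/E.
Qed.

Definition ultra_type : set (formula_over M) := [set th | big (fun x => sat_over id th [:: x])].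

Lemma ultra_type_is_type : is_type1 ultra_type.
Proof.
split=> [F Ffin Fp|f e]; last first.
  have [|h|h] := @big_ultra (fun x => sat (scons x e) f); first exact: dpred_sat.
  - by left.
  - by right.
have [|k hk] := @finite_directed _ nat F
    (fun th k => forall x, mem (s k) (l k) x -> sat_over id th [:: x]) 0%N Ffin _ Fp.
  move=> k k'; exists (maxn k k') => th [h|h] x hx; apply: h; apply: s_mono hx.
    exact: leq_maxl.
  exact: leq_maxr.
by have [x [_ [hx _ _]]] := s_two k; exists x => th /hk; apply.
Qed.

Lemma ultra_type_dpred (A : M -> Prop) : dpred setT A ->
  exists th : formula_over M, forall x, sat_over id th [:: x] <-> A x.
Proof.
move=> /dpred_Def[th E]; exists th => x.
have : [set x | A x] x = [set x | sat_over id th [:: x]] x by rewrite E.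
by rewrite /= => ->.
Qed.

(** An isolating formula would be satisfied by some [m] in the chain, while every
    definable set that avoids [m] but contains a member of the chain is in the
    type. *)
Lemma ultra_type_nonprincipal : ~ principal ultra_type.
Proof.
move=> [phi [k hk] hphi].
have [m [_ [hm _ _]]] := s_two k.
have [|th hth] := @ultra_type_dpred (fun x => x <> m); first by dfn_auto.
have pth : ultra_type th.
  have [|[k' h']|h] := @big_ultra (fun x => x = m); first by dfn_auto.
    have [x [y [hx hy]]] := s_two k'; case.
    by rewrite (h' x hx) (h' y hy).
  by apply: big_imp h => x /hth.
by have /hth := hphi th pth m (hk m hm).
Qed.

Lemma decr_rev (S : M -> Prop) xs : (forall i, (i < size xs)%N -> S (nth 0 xs i)) ->
  (forall i, (i.+1 < size xs)%N -> nth 0 xs i < nth 0 xs i.+1) -> decr S (rev xs).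
Proof.
elim/last_ind: xs S => [//|xs z IH] S hS hlt; rewrite rev_rcons /=.
have hz : nth 0 (rcons xs z) (size xs) = z by rewrite nth_rcons ltnn eqxx.
split; first by rewrite -hz; apply: hS; rewrite size_rcons.
apply: IH => i ix; last first.
  have := hlt i; rewrite size_rcons !nth_rcons ix (ltnW ix) => h; apply: h.
  exact: ltnW.
split; first by have := hS i; rewrite size_rcons nth_rcons ix => h; apply: h; apply: ltnW.
suff H k : (i < k)%N -> (k <= size xs)%N -> nth 0 (rcons xs z) i < nth 0 (rcons xs z) k.
  by have := H _ ix (leqnn _); rewrite hz nth_rcons ix.
elim: k => // k IHk; rewrite ltnS leq_eqVlt => /orP[/eqP <-|ik] kx.
  by apply: hlt; rewrite size_rcons.
apply: lta_trans (IHk ik (ltnW kx)) _; apply: hlt; by rewrite size_rcons.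
Qed.

Lemma ultra_type_indiscernible : indiscernible ultra_type.
Proof.
move=> n n1; split; first exact: ultra_type_nonprincipal.
move=> [f e].
pose G k : (nat -> M) -> M := if (k < n)%N then fun w => w (n - k.+1)%N else fun=> e (k - n)%N.
have [|k hom] := s_hom n (P := fun w => sat (G^~ w) f).
  by apply: dfn_sat => k; rewrite /G; case: (k < n)%N; dfn_auto.
have [|phi hphi] := @ultra_type_dpred (mem (s k) (l k)); first by rewrite /mem; dfn_auto.
exists phi; first by exists k => x /hphi.
move=> x y hxy incx incy.
have E (z : n.-tuple M) : sat_over id (f, e) z <->
    sat (fun i => G i (foldr (@scons M) (fun=> 0) (rev z))) f.
  rewrite /sat_over /= (_ : foldr _ _ _ = (fun i => G i (foldr (@scons M) (fun=> 0) (rev z)))) //.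
  apply/funext => i; rewrite /G; case: (ltnP i n) => hi.
    have hi' : (n - i.+1 < n)%N by rewrite ltn_subrL /=; apply: leq_ltn_trans hi.
    rewrite !(foldr_scons_nth _ 0) ?size_rev ?size_tuple // nth_rev ?size_tuple //.
    by rewrite -subSn // subSS subKn // ltnW.
  by have := foldr_scons_ge (id \o e) z (i - n); rewrite size_tuple subnKC.
have d (z : n.-tuple M) : (forall i, sat_over id phi [:: tnth z i]) -> increasing z ->
    decr (mem (s k) (l k)) (rev z).
  move=> hz incz; apply: decr_rev => i; rewrite size_tuple => hi.
    by have /hphi := hz (Ordinal hi); rewrite (tnth_nth 0).
  have := incz (Ordinal (ltnW hi)) (Ordinal hi) erefl.
  by rewrite !(tnth_nth 0).
rewrite !E; apply: hom; rewrite ?size_rev ?size_tuple //.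
- by apply: d => // i; have [] := hxy i.
- by apply: d => // i; have [] := hxy i.
- exact: cut_0.
Qed.

Lemma ultra_type_realized : realizes diag (cls idf : ultrapower) ultra_type.
Proof.
move=> [f e] h; rewrite /sat_over /=.
pose G i := if i is i'.+1 then cst (e i') else idf.
have -> : scons (cls idf : ultrapower) (diag \o e) = fun i => cls (G i) by apply/funext => -[].
apply/los; apply: big_imp h => x; rewrite /sat_over /=.
by rewrite (_ : (fun i => _) = scons x (id \o e)) //; apply/funext => -[].
Qed.

End Ultrapower.

(** * The three conditions *)

Theorem theorem3p3 (M : arith_structure) (I : set M)
    (M_PA : models M PA)
    (I_cut : is_cut I)
    (M_gen : countably_generated_over I) :
  [<-> dcf_is I [set: nat] /\ exp_closed I;
       exists (N : arith_structure) (j : M -> N),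
         [/\ cofinal_extension j, countably_generated_extension j,
             GCIS j = I & same_Cod j I];
       exists (N : arith_structure) (j : M -> N),
         [/\ cofinal_extension j,
             ~ filling j,
             exists (c : N) (p : set (formula_over M)),
               [/\ generated_by j c, is_type1 p, indiscernible p
                 & realizes j c p],
             GCIS j = I & same_Cod j I]].
Proof.
have HM : PA_model M := M_PA.
set P1 := _ /\ _; set P2 := ex _; set P3 := ex _.
have H13 : P1 -> P3.
  move=> [/(seq_of_dcf I_cut)[b [bI bcof]] I_exp].
  have [X cX genM] := M_gen.
  have [s [l [s_inc l_out s_sub lb s_hom]]] := homogeneous_chain I_cut I_exp cX genM bI.
  have GI : GCIS (diag s l) = I.
    apply: (ultra_GCIS I_cut s_inc l_out s_sub s_hom) => x /bcof[n bx].
    by exists n.+1; apply: lea_trans (lb n) bx.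
  exists (ultrapower s l), (diag s l); split=> //.
  - exact (ultra_cofinal I_cut s_inc l_out s_sub s_hom).
  - exact (ultra_not_filling I_cut s_inc l_out s_sub s_hom GI).
  - exists (cls s l (idf M)), (ultra_type s l); split.
    + exact (ultra_generated I_cut s_inc l_out s_sub s_hom).
    + exact (ultra_type_is_type I_cut s_inc l_out s_sub s_hom).
    + exact (ultra_type_indiscernible I_cut s_inc l_out s_hom).
    + exact (ultra_type_realized I_cut s_inc l_out s_sub s_hom).
  - exact (ultra_same_Cod I_cut s_inc l_out s_sub s_hom).
have H32 : P3 -> P2.
  move=> [N [j [cof _ [c [p [gen _ _ _]]] GI CI]]]; exists N, j; split=> //.
  by exists [set c]; [exact: countable1|rewrite setUC].
have H21 : P2 -> P1.
  move=> [N [j [[[j_el _] _] gen GI CI]]].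
  have HN : PA_model N := elementary_PA j_el HM.
  split; first exact: extension_dcf GI CI M_gen gen.
  exact: extension_exp_closed GI CI.
by tfae=> [/H13/H32|/H21/H13|/H32/H21].
Qed.
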